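(* Let $K$ be an algebraically closed field and let $n\ge 3$. Any $\operatorname{Ind}$-scheme automorphism $\varphi$ of $\operatorname{NAut}(K[x_1,\dots,x_n])$ is inner, i.e. is a conjugation via some automorphism.
   Context: An $\operatorname{Ind}$-variety $M$ is the direct limit of algebraic varieties $M_1\subseteq M_2\subseteq\cdots$ (closed embeddings). An $\operatorname{Ind}$-scheme (Ind-group) is an $\operatorname{Ind}$-variety which is a group such that inversion restricts to morphisms $M_i\to M_{j(i)}$ and multiplication to morphisms $M_i\times M_j\to M_{k(i,j)}$. A map $\varphi:M\to N$ of $\operatorname{Ind}$-varieties is a morphism if for every $i$ there is $j(i)$ with $\varphi(M_i)\subseteq N_{j(i)}$ and $\varphi|_{M_i}$ a morphism of varieties. An $\operatorname{Ind}$-scheme automorphism of such a group is a group automorphism which is an isomorphism of $\operatorname{Ind}$-varieties. The group $\operatorname{Aut}(K[x_1,\dots,x_n])$ of $K$-algebra automorphisms is filtered by the algebraic sets of automorphisms $\varphi$ with $\deg\varphi,\deg\varphi^{-1}\le N$ (degree = maximal total degree of the images of the generators; coordinates are the coefficients of the images of generators under $\varphi$ and $\varphi^{-1}$). An automorphism is elementary if it has the form $x_i\mapsto x_i+P$, $x_j\mapsto x_j$ ($j\neq i$) with $P$ independent of $x_i$; $\operatorname{TAut}$ is the subgroup generated by linear and elementary automorphisms. An automorphism $\varphi$ is nice if for every $m$ there are $\psi_m\in\operatorname{Aut}(K[x_1,\dots,x_n])$ and $\phi_m\in\operatorname{TAut}(K[x_1,\dots,x_n])$ with $\varphi=\psi_m\phi_m$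 and $\psi_m(x_i)\equiv x_i \bmod (x_1,\dots,x_n)^m$ for all $i$. $\operatorname{NAut}(K[x_1,\dots,x_n])$ is the group of nice automorphisms, with the filtration induced from $\operatorname{Aut}(K[x_1,\dots,x_n])$. *)

(* Defs.v *)
From Stdlib Require Import FunctionalExtensionality ProofIrrelevance.
From HB Require Import structures.
From mathcomp Require Import all_boot all_algebra.
From mathcomp Require Import mpoly.

Set Implicit Arguments.
Unset Strict Implicit.
Unset Printing Implicit Defensive.

Import GRing.Theory.
Local Open Scope ring_scope.

Section PolyAut.
Variables (K : closedFieldType) (n : nat).

Record polyAut := PolyAut {
  aut_fun :> {lrmorphism {mpoly K[n]} -> {mpoly K[n]}};
  aut_ifun : {lrmorphism {mpoly K[n]} -> {mpoly K[n]}};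
  aut_funK : cancel aut_fun aut_ifun;
  aut_ifunK : cancel aut_ifun aut_fun
}.

Lemma lrmorphism_ext (f g : {lrmorphism {mpoly K[n]} -> {mpoly K[n]}}) :
  f =1 g -> f = g.
Proof.
case: f => f [[[fa fb]] [fc] [fd]]; case: g => g [[[ga gb]] [gc] [gd]] /= E.
have E' : f = g by apply: functional_extensionality.
case: _ / E' in ga gb gc gd E *.
by rewrite (proof_irrelevance _ fa ga) (proof_irrelevance _ fb gb)
  (proof_irrelevance _ fc gc) (proof_irrelevance _ fd gd).
Qed.

(* Hence Leibniz equality on [polyAut] is equality of automorphisms, even
   though the inverse is recorded as data. *)
Lemma polyAut_ext (f g : polyAut) : f =1 g -> f = g.
Proof.
case: f => f f' fK f'K; case: g => g g' gK g'K /= E.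
have E1 : f = g by exact: lrmorphism_ext.
have E2 : f' = g'.
  by apply: lrmorphism_ext => x; rewrite -{1}(g'K x) -E1 fK.
case: _ / E1 in gK g'K E *; case: _ / E2 in gK g'K *.
by rewrite (proof_irrelevance _ fK gK) (proof_irrelevance _ f'K g'K).
Qed.

Definition aut_one : polyAut :=
  @PolyAut idfun idfun (fun=> erefl) (fun=> erefl).

Definition aut_inv (f : polyAut) : polyAut :=
  PolyAut (@aut_ifunK f) (@aut_funK f).

(* The product is composition of maps: [aut_mul f g] sends p to f (g p). *)
Definition aut_mul (f g : polyAut) : polyAut :=
  @PolyAut (aut_fun f \o aut_fun g) (aut_ifun g \o aut_ifun f)
    (can_comp (@aut_funK f) (@aut_funK g))
    (can_comp (@aut_ifunK g) (@aut_ifunK f)).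

(* [msize p] is 1 + the total degree of p for p != 0. *)
Definition aut_deg (f : polyAut) : nat := \max_(i < n) (msize (f 'X_i)).-1.

Definition linear_aut (f : polyAut) : Prop :=
  exists A : 'M[K]_n, forall i, f 'X_i = \sum_j A i j *: 'X_j.

Definition elementary_aut (f : polyAut) : Prop :=
  exists i : 'I_n, exists P : {mpoly K[n]},
    [/\ forall m, m \in msupp P -> m i = 0%N,
        f 'X_i = 'X_i + P
      & forall j, j != i -> f 'X_j = 'X_j].

(* TAut, the subgroup generated by linear and elementary automorphisms *)
Inductive tame : polyAut -> Prop :=
| tame_linear f : linear_aut f -> tame f
| tame_elementary f : elementary_aut f -> tame f
| tame_one : tame aut_one
| tame_mul f g : tame f -> tame g -> tame (aut_mul f g)
| tame_inv f : tame f -> tame (aut_inv f).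

(* The power (x_1, ..., x_n)^m, by (x)^(m+1) = (x)^m . (x) *)
Fixpoint in_max_pow (m : nat) (p : {mpoly K[n]}) : Prop :=
  if m is m'.+1 then
    exists q : 'I_n -> {mpoly K[n]},
      (forall i, in_max_pow m' (q i)) /\ p = \sum_i q i * 'X_i
  else True.

Definition nice (f : polyAut) : Prop :=
  forall m : nat, exists psi phi : polyAut,
    [/\ tame phi, f = aut_mul psi phi
      & forall i, in_max_pow m (psi 'X_i - 'X_i)].

Record NAut := MkNAut { nval :> polyAut; nvalP : nice nval }.

Definition nstage (N : nat) (f : NAut) : Prop :=
  (aut_deg f <= N)%N /\ (aut_deg (aut_inv f) <= N)%N.

(* (b, i, m) indexes the coefficient of the monomial m, of degree at most N, in
   the image of x_i under f (b = false) or under f^-1 (b = true). *)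
Definition coord_index (N : nat) : finType :=
  (bool * 'I_n * 'X_{1..n < N.+1})%type.

Definition coord (N : nat) (f : NAut) (c : coord_index N) : K :=
  let: (b, i, m) := c in ((if b then aut_inv f else f) 'X_i)@_m.

Definition coords (N : nat) (f : NAut) : 'I_#|coord_index N| -> K :=
  fun k => coord f (enum_val k).

(* h is a regular function on the subset X, embedded in affine d-space by c
   (with the induced structure): Zariski-locally on X, it is a quotient p / q
   of polynomials in the coordinates, with q nowhere zero. The principal open
   sets u != 0 form a basis of the Zariski topology. When the image of X is
   closed this is the same as being the restriction of a polynomial. *)
Definition regular_on (T : Type) (X : T -> Prop) (d : nat)
    (c : T -> 'I_d -> K) (h : T -> K) : Prop :=
  forall t, X t -> exists u p q : {mpoly K[d]},
    u.@[c t] != 0 /\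
    forall s, X s -> u.@[c s] != 0 -> q.@[c s] != 0 /\ h s = p.@[c s] / q.@[c s].

Definition ind_morphism (Phi : NAut -> NAut) : Prop :=
  forall N, exists M,
    (forall f, nstage N f -> nstage M (Phi f)) /\
    forall c : coord_index M,
      regular_on (nstage N) (@coords N) (fun f => coord (Phi f) c).

(* The group law of NAut is the one of [polyAut]; multiplicativity is stated on
   triples so that it needs no prior proof that products of nice automorphisms
   are nice. *)
Definition naut_multiplicative (Phi : NAut -> NAut) : Prop :=
  forall f g h : NAut, nval h = aut_mul f g ->
    nval (Phi h) = aut_mul (Phi f) (Phi g).

Definition ind_automorphism (Phi : NAut -> NAut) : Prop :=
  [/\ naut_multiplicative Phi,
      ind_morphism Phi
    & exists Psi : NAut -> NAut,
        [/\ cancel Phi Psi, cancel Psi Phi & ind_morphism Psi]].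

End PolyAut.

(* Main.v *)
From Stdlib Require Import ProofIrrelevance Classical ClassicalEpsilon.
Require Import Defs.
From HB Require Import structures.
From mathcomp Require Import all_boot all_order all_algebra.
From mathcomp Require Import mpoly ring.

Set Implicit Arguments.
Unset Strict Implicit.
Unset Printing Implicit Defensive.

Import Order.TTheory GRing.Theory Num.Theory.
Local Open Scope ring_scope.

(** The diagonal torus and its root subgroups [x_i |-> x_i + c x^m] (with [m i = 0]) rigidify the
    group. A morphism sends curves to curves, so [Phi] maps each one-parameter subgroup of the torus
    to automorphisms whose coefficients are Laurent polynomials in the parameter. The image of the
    torus therefore grades K[x_1, ..., x_n] by Z^n ([torus_dec]), and injectivity of [Phi] gives the
    weights rank n ([torus_full_grading]). Such a grading has weight coordinates ([linearize], the
    theorem of Bialynicki-Birula): weight spaces are lines ([wt_line]), the vectors of nonzero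
    weight span the maximal ideal of a fixed point, and weight vectors with independent
    differentials there generate the algebra. After a conjugation the image of the torus is
    diagonal.

    The torus normalizes a root subgroup through the character m - e_i. Comparing weights, the image
    of a root subgroup is again a root subgroup ([V_root]), linearly parametrized because the
    inverse of [Phi] is a morphism too ([conj_root]). A linear map that sends all the vectors m -
    e_i to vectors of this kind is given by a permutation matrix ([N_row]), which a permutation of
    the variables absorbs; a diagonal conjugation then makes the resulting map [C] fix the torus and
    the translations ([exists_normalization]), and [C] only rescales the other root subgroups.

    Translations relate the scaling factor of each root subgroup to that of the constants, so every
    factor is 1 ([C_root_fixed]) and elementary automorphisms are fixed. A linear automorphism is
    determined by its action on translations and homotheties ([C_linear]), so tame automorphisms are
    fixed ([C_tame]). A nice automorphism is a limit of tame ones for the order of vanishing at the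
    origin, and [C] respects that order ([C_preserves_order]), so it is fixed as well ([C_nice]). *)

(** * Substitutions, diagonal and elementary automorphisms, translations *)

Section Substitutions.
Variables (K : closedFieldType) (n : nat).
Local Notation R := {mpoly K[n]}.
Implicit Types (f g h : polyAut K n) (p q P Q : R) (i j k : 'I_n).

(* [subst], [diag], [elem] and [transl] are built from opaque existence proofs:
   conversion must not unfold them. *)
Fact subst_subproof (y : 'I_n -> R) :
  {f : {lrmorphism R -> R} | (forall i, f 'X_i = y i) &
     (forall p, f p = \sum_(m <- msupp p) p@_m *: \prod_i y i ^+ m i)}.
Proof.
exists (comp_mpoly [tuple y i | i < n]) => [i|p] /=.
  by rewrite comp_mpolyXU -tnth_nth tnth_mktuple.
rewrite comp_mpolyE; apply: eq_bigr => m _; congr (_ *: _).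
by apply: eq_bigr => i _; rewrite tnth_mktuple.
Qed.

Definition subst y : {lrmorphism R -> R} := s2val (subst_subproof y).

Lemma substX y i : subst y 'X_i = y i.
Proof. exact: (s2valP (subst_subproof y)). Qed.

Lemma substE y p :
  subst y p = \sum_(m <- msupp p) p@_m *: \prod_i y i ^+ m i.
Proof. exact: (s2valP' (subst_subproof y)). Qed.

Lemma lrmorphZ (f : {lrmorphism R -> R}) c p : f (c *: p) = c *: f p.
Proof. exact: linearZ. Qed.

Lemma lrmorphC (f : {lrmorphism R -> R}) c : f c%:MP = c%:MP.
Proof. by rewrite -!alg_mpolyC lrmorphZ rmorph1. Qed.

Lemma lrmorphD (f : {lrmorphism R -> R}) p q : f (p + q) = f p + f q.
Proof. exact: rmorphD. Qed.

Lemma lrmorphB (f : {lrmorphism R -> R}) p q : f (p - q) = f p - f q.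
Proof. exact: rmorphB. Qed.

Lemma lrmorphM (f : {lrmorphism R -> R}) p q : f (p * q) = f p * f q.
Proof. exact: rmorphM. Qed.

Lemma lrmorph_mpolyE (f : {lrmorphism R -> R}) p :
  f p = \sum_(m <- msupp p) p@_m *: \prod_i f 'X_i ^+ m i.
Proof.
rewrite {1}[p]mpolyE rmorph_sum /=; apply: eq_bigr => m _.
rewrite lrmorphZ; congr (_ *: _); rewrite mpolyXE_id rmorph_prod.
by apply: eq_bigr => i _; rewrite rmorphXn.
Qed.

Lemma lrmorph_eqX (f g : {lrmorphism R -> R}) :
  (forall i, f 'X_i = g 'X_i) -> f =1 g.
Proof.
move=> fg p; rewrite !lrmorph_mpolyE; apply: eq_bigr => m _.
by congr (_ *: _); apply: eq_bigr => i _; rewrite fg.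
Qed.

Lemma aut_eqX f g : (forall i, f 'X_i = g 'X_i) -> f = g.
Proof. by move=> fg; apply/polyAut_ext/lrmorph_eqX. Qed.

Lemma subst_cancel y z : (forall i, subst z (y i) = 'X_i) ->
  cancel (subst y) (subst z).
Proof.
move=> yz p; apply: (@lrmorph_eqX (subst z \o subst y) idfun) => i.
by rewrite /= substX yz.
Qed.

Definition subst_aut y z (yz : forall i, subst z (y i) = 'X_i)
  (zy : forall i, subst y (z i) = 'X_i) : polyAut K n :=
  PolyAut (subst_cancel yz) (subst_cancel zy).

Local Notation "f ** g" := (aut_mul f g) (at level 40, left associativity).
Local Notation one := (aut_one K n).

Lemma aut_mulE f g p : (f ** g) p = f (g p). Proof. by []. Qed.
Lemma aut_mulA f g h : f ** (g ** h) = f ** g ** h.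
Proof. exact: polyAut_ext. Qed.
Lemma aut_VK f p : aut_inv f (f p) = p. Proof. exact: aut_funK. Qed.
Lemma aut_mul1 f : f ** one = f. Proof. exact: polyAut_ext. Qed.
Lemma aut_1mul f : one ** f = f. Proof. exact: polyAut_ext. Qed.
Lemma aut_mulV f : f ** aut_inv f = one.
Proof. by apply: polyAut_ext => p /=; rewrite aut_ifunK. Qed.
Lemma aut_Vmul f : aut_inv f ** f = one.
Proof. by apply: polyAut_ext => p /=; rewrite aut_funK. Qed.
Lemma aut_mulKV f g : f ** g ** aut_inv g = f.
Proof. by rewrite -aut_mulA aut_mulV aut_mul1. Qed.
Lemma aut_mulVK f g : f ** aut_inv g ** g = f.
Proof. by rewrite -aut_mulA aut_Vmul aut_mul1. Qed.
Lemma aut_mulI f g h : f ** g = f ** h -> g = h.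
Proof.
by move=> E; rewrite -[g]aut_1mul -(aut_Vmul f) -aut_mulA E aut_mulA aut_Vmul
  aut_1mul.
Qed.
Lemma aut_Imul f g h : g ** f = h ** f -> g = h.
Proof. by move=> E; rewrite -[g](aut_mulKV _ f) E aut_mulKV. Qed.
Lemma aut_inv_mul f g : aut_inv (f ** g) = aut_inv g ** aut_inv f.
Proof. exact: polyAut_ext. Qed.
Lemma aut_inv_eq f g : f ** g = one -> aut_inv f = g.
Proof. by move=> E; apply: (@aut_mulI f); rewrite aut_mulV. Qed.
Lemma aut_invK f : aut_inv (aut_inv f) = f.
Proof. exact: polyAut_ext. Qed.
Lemma aut_inj f : injective f. Proof. exact: can_inj (@aut_funK _ _ f). Qed.
Lemma autZ f c p : f (c *: p) = c *: f p. Proof. exact: lrmorphZ. Qed.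
Lemma autC f c : f c%:MP = c%:MP.
Proof. exact: lrmorphC. Qed.

Definition unz (c : K) := if c == 0 then 1 else c.
Lemma unz_neq0 c : unz c != 0.
Proof. by rewrite /unz; case: ifP => [_|/negbT //]; apply: oner_neq0. Qed.
Lemma unzE c : c != 0 -> unz c = c.
Proof. by rewrite /unz => /negPf ->. Qed.

Fact diag_proof (s : 'I_n -> K) i :
  subst (fun i => (unz (s i))^-1 *: 'X_i) (unz (s i) *: 'X_i) = 'X_i.
Proof. by rewrite lrmorphZ substX scalerA mulfV ?unz_neq0 // scale1r. Qed.
Fact diag_proofV (s : 'I_n -> K) i :
  subst (fun i => unz (s i) *: 'X_i) ((unz (s i))^-1 *: 'X_i) = 'X_i.
Proof. by rewrite lrmorphZ substX scalerA mulVf ?unz_neq0 // scale1r. Qed.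

Fact diag_subproof s :
  {f : polyAut K n | (forall j, f 'X_j = unz (s j) *: 'X_j) &
     (forall j, aut_inv f 'X_j = (unz (s j))^-1 *: 'X_j)}.
Proof. by exists (subst_aut (diag_proof s) (diag_proofV s)) => j; apply: substX. Qed.

(* Zero entries of [s] are read as 1, so that [diag] is total. *)
Definition diag s : polyAut K n := s2val (diag_subproof s).

Lemma diagX s i : diag s 'X_i = unz (s i) *: 'X_i.
Proof. exact: (s2valP (diag_subproof s)). Qed.

Lemma diag_invX s i : aut_inv (diag s) 'X_i = (unz (s i))^-1 *: 'X_i.
Proof. exact: (s2valP' (diag_subproof s)). Qed.
Definition kill i : {lrmorphism R -> R} :=
  subst (fun j => if j == i then 0 else 'X_j).

Lemma kill_fix i (phi : {lrmorphism R -> R}) p :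
  (forall j, j != i -> phi 'X_j = 'X_j) -> phi (kill i p) = kill i p.
Proof.
move=> fix_phi.
apply: (@lrmorph_eqX (phi \o kill i) (kill i)) => j.
change (phi (kill i 'X_j) = kill i 'X_j); rewrite substX.
by case: eqP => [_|/eqP /fix_phi //]; rewrite rmorph0.
Qed.

Lemma kill_id i p : (forall m, m \in msupp p -> m i = 0%N) -> kill i p = p.
Proof.
move=> Hp; rewrite substE {3}[p]mpolyE; apply: eq_big_seq => m /Hp mi.
rewrite mpolyXE_id; congr (_ *: _); apply: eq_bigr => j _.
by case: eqP => // ->; rewrite mi !expr0.
Qed.

Lemma killX i (m : 'X_{1..n}) : m i = 0%N -> kill i 'X_[m] = 'X_[m].
Proof. by move=> mi; apply: kill_id => m'; rewrite msuppX inE => /eqP ->. Qed.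

Fact elem_proof i P j :
  subst (fun j => if j == i then 'X_i + kill i P else 'X_j)
    (if j == i then 'X_i - kill i P else 'X_j) = 'X_j.
Proof.
case: eqP => [->|/eqP /negPf ji]; last by rewrite substX ji.
rewrite lrmorphB substX eqxx kill_fix ?addrK // => k ki.
by rewrite substX (negPf ki).
Qed.

Fact elem_proofV i P j :
  subst (fun j => if j == i then 'X_i - kill i P else 'X_j)
    (if j == i then 'X_i + kill i P else 'X_j) = 'X_j.
Proof.
case: eqP => [->|/eqP /negPf ji]; last by rewrite substX ji.
rewrite lrmorphD substX eqxx kill_fix ?subrK // => k ki.
by rewrite substX (negPf ki).
Qed.

Fact elem_subproof i P :
  {f : polyAut K n | (forall j, f 'X_j = if j == i then 'X_i + kill i P else 'X_j) &
     (forall j, aut_inv f 'X_j = if j == i then 'X_i - kill i P else 'X_j)}.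
Proof. by exists (subst_aut (elem_proofV i P) (elem_proof i P)) => j; apply: substX. Qed.

(* [x_i] is substituted by 0 in [P], so that [elem i P] is total. *)
Definition elem i P : polyAut K n := s2val (elem_subproof i P).

Lemma elemX i P j :
  elem i P 'X_j = if j == i then 'X_i + kill i P else 'X_j.
Proof. exact: (s2valP (elem_subproof i P)). Qed.

Lemma elem_invX i P j :
  aut_inv (elem i P) 'X_j = if j == i then 'X_i - kill i P else 'X_j.
Proof. exact: (s2valP' (elem_subproof i P)). Qed.

Lemma elem_kill i P Q : elem i P (kill i Q) = kill i Q.
Proof. by apply: kill_fix => k ki; rewrite elemX (negPf ki). Qed.

Lemma elemD i P Q : elem i (P + Q) = elem i P ** elem i Q.
Proof.
move def_S: (P + Q) => S; apply: aut_eqX => j; rewrite aut_mulE (elemX i Q).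
rewrite elemX; case: eqP => [_|/eqP/negPf ji]; last by rewrite elemX ji.
by rewrite -def_S lrmorphD [RHS]lrmorphD elemX eqxx elem_kill addrA.
Qed.

Lemma elem0 i : elem i 0 = one.
Proof.
by apply: aut_eqX => j; rewrite elemX rmorph0 addr0; case: eqP => [->|].
Qed.

Fact transl_proof (v : 'I_n -> K) i :
  subst (fun i => 'X_i - (v i)%:MP) ('X_i + (v i)%:MP) = 'X_i.
Proof.
by rewrite lrmorphD substX lrmorphC subrK.
Qed.
Fact transl_proofV (v : 'I_n -> K) i :
  subst (fun i => 'X_i + (v i)%:MP) ('X_i - (v i)%:MP) = 'X_i.
Proof.
by rewrite lrmorphB substX lrmorphC addrK.
Qed.

Fact transl_subproof (v : 'I_n -> K) :
  {f : polyAut K n | (forall j, f 'X_j = 'X_j + (v j)%:MP) &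
     (forall j, aut_inv f 'X_j = 'X_j - (v j)%:MP)}.
Proof. by exists (subst_aut (transl_proof v) (transl_proofV v)) => j; apply: substX. Qed.

Definition transl v : polyAut K n := s2val (transl_subproof v).

Lemma translX v i : transl v 'X_i = 'X_i + (v i)%:MP.
Proof. exact: (s2valP (transl_subproof v)). Qed.

Lemma transl_invX v i : aut_inv (transl v) 'X_i = 'X_i - (v i)%:MP.
Proof. exact: (s2valP' (transl_subproof v)). Qed.

Lemma tame_diag s : tame (diag s).
Proof.
apply: tame_linear; exists (diag_mx (\row_j unz (s j))) => i.
rewrite diagX (bigD1 i) //= big1 ?addr0 => [|j ji].
  by rewrite mxE eqxx mxE mulr1n.
by rewrite mxE eq_sym (negPf ji) mulr0n scale0r.
Qed.

Lemma tame_elem i P : tame (elem i P).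
Proof.
apply: tame_elementary; exists i, (kill i P); split.
- move=> m; rewrite mcoeff_msupp => Hm; apply/eqP; apply: contraNT Hm => mi.
  rewrite substE raddf_sum big1 //= => m' _; rewrite mcoeffZ.
  have [m'i|m'i] := eqVneq (m' i) 0%N; last first.
    by rewrite (bigD1 i) //= eqxx expr0n (negPf m'i) mul0r mcoeff0 mulr0.
  rewrite (eq_bigr (fun j => 'X_j ^+ m' j)) => [|j _]; last first.
    by case: eqP => // ->; rewrite m'i !expr0.
  rewrite -mpolyXE_id mcoeffX; case: eqP => [E|_]; last by rewrite mulr0.
  by rewrite -E m'i eqxx in mi.
- by rewrite elemX eqxx.
- by move=> j ji; rewrite elemX (negPf ji).
Qed.

Lemma elem_transl i (c : K) :
  elem i c%:MP = transl (fun j => if j == i then c else 0).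
Proof.
apply: aut_eqX => j; rewrite elemX translX; case: eqP => [->|_].
  by rewrite lrmorphC.
by rewrite rmorph0 addr0.
Qed.

Lemma translD v w : transl v ** transl w = transl (fun i => v i + w i).
Proof.
apply: aut_eqX => i; rewrite aut_mulE !translX lrmorphD translX autC.
by rewrite -addrA -rmorphD.
Qed.

(** A translation is a composite of translations along single variables, and these are
    elementary. *)
Lemma transl_ind (G : polyAut K n -> Prop) :
    G one -> (forall f g, G f -> G g -> G (f ** g)) ->
    (forall i c, G (elem i c%:MP)) ->
  forall v, G (transl v).
Proof.
move=> G1 GM Gelem v.
(* Induction on the number of leading coordinates of [v] that are kept, the others being set to
   0. *)
suff H (k : nat) : (k <= n)%N -> G (transl (fun j => if (j < k)%N then v j else 0)).
  have := H n (leqnn n); congr (G _).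
  by apply: aut_eqX => i; rewrite !translX ltn_ord.
elim: k => [_|k IH lt_kn].
  move: G1; congr (G _).
  by apply: aut_eqX => i; rewrite translX ltn0 rmorph0 addr0.
have -> : transl (fun j => if (j < k.+1)%N then v j else 0) =
    transl (fun j => if (j < k)%N then v j else 0)
      ** elem (Ordinal lt_kn) (v (Ordinal lt_kn))%:MP.
  rewrite elem_transl translD; apply: aut_eqX => i; rewrite !translX ltnS leq_eqVlt.
  rewrite -val_eqE /=; have [E|_] := eqVneq (i : nat) k.
    rewrite E ltnn add0r; congr (_ + (v _)%:MP); exact: val_inj.
  by rewrite /= addr0.
apply: GM; last exact: Gelem.
exact/IH/ltnW.
Qed.

Lemma tame_transl v : tame (transl v).
Proof.
apply: (transl_ind (G := @tame K n)) => [|f g|i c].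
- exact: tame_one.
- exact: tame_mul.
- exact: tame_elem.
Qed.

End Substitutions.

(** * Rings of functions on a curve closed under patching local quotients *)

Section LocalToGlobal.
Variable K : closedFieldType.
Implicit Types (p q u s : {poly K}) (h : K -> K).

Lemma poly_eq0_horner p : (forall t, p.[t] = 0) -> p = 0.
Proof.
move=> p0; apply/eqP/negPn/negP => /closed_nonrootP [t].
by rewrite rootE p0 eqxx.
Qed.

Lemma poly_eq0_horner_nz p : (forall t, t != 0 -> p.[t] = 0) -> p = 0.
Proof.
move=> p0; have /eqP : p * 'X = 0.
  apply: poly_eq0_horner => t; rewrite hornerMX.
  by have [->|/p0 ->] := eqVneq t 0; rewrite ?mulr0 ?mul0r.
by rewrite mulf_eq0 polyX_eq0 orbF => /eqP.
Qed.

Lemma expf_neq1 k : (0 < k)%N -> exists2 t : K, t != 0 & t ^+ k != 1.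
Proof.
move=> k0; have /closed_nonrootP [t] : ('X^k - 1) * 'X != 0 :> {poly K}.
  by rewrite mulf_neq0 ?polyX_eq0 // -size_poly_eq0 size_XnsubC.
rewrite rootM rootE !hornerE negb_or subr_eq0 rootX => /andP[t1 t0].
by exists t.
Qed.

(** One reduced fraction [P / Q] serves everywhere. Two local fractions agree off a finite set,
    hence as rational functions, and coprimality of [P] and [Q] prevents [Q] from vanishing where
    another fraction has a nonzero denominator. *)
Lemma rational_local_global s h : s != 0 ->
    (forall t0, s.[t0] != 0 -> exists u p q, u.[t0] != 0 /\
      forall t, s.[t] != 0 -> u.[t] != 0 -> q.[t] != 0 /\ h t = p.[t] / q.[t]) ->
  exists p q, forall t, s.[t] != 0 -> q.[t] != 0 /\ h t = p.[t] / q.[t].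
Proof.
move=> /closed_nonrootP [t0 st0] loc.
have [u0 [p0 [q0 [u0t0 H0]]]] := loc t0 st0.
have q0N0 : q0 != 0.
  by apply: contraTneq (H0 t0 st0 u0t0).1 => ->; rewrite horner0 eqxx.
pose g := gcdp p0 q0; have gN0 : g != 0 by rewrite gcdp_eq0 negb_and q0N0 orbT.
have Ep : p0 = p0 %/ g * g by rewrite divpK ?dvdp_gcdl.
have Eq : q0 = q0 %/ g * g by rewrite divpK ?dvdp_gcdr.
have cop : coprimep (p0 %/ g) (q0 %/ g) by rewrite coprimep_div_gcd ?q0N0 ?orbT.
set P := p0 %/ g in Ep cop; set Q := q0 %/ g in Eq cop.
exists P, Q => t1 st1.
have [u1 [p1 [q1 [u1t1 H1]]]] := loc t1 st1.
have PQ : P * q1 = p1 * Q.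
  have /eqP : (p0 * q1 - p1 * q0) * (s * u0 * u1) = 0.
    apply: poly_eq0_horner => t; rewrite !hornerM hornerD hornerN !hornerM.
    have [->|st] := eqVneq s.[t] 0; first by rewrite !mul0r mulr0.
    have [->|u0t] := eqVneq u0.[t] 0; first by rewrite mulr0 mul0r mulr0.
    have [->|u1t] := eqVneq u1.[t] 0; first by rewrite !mulr0.
    have [q0t h0] := H0 t st u0t; have [q1t] := H1 t st u1t.
    rewrite h0 => /eqP; rewrite eqr_div // => /eqP ->.
    by rewrite subrr mul0r.
  have u0N0 : u0 != 0 by apply: contraNneq u0t0 => ->; rewrite horner0.
  have u1N0 : u1 != 0 by apply: contraNneq u1t1 => ->; rewrite horner0.
  have sN0 : s != 0 by apply: contraNneq st1 => ->; rewrite horner0.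
  rewrite mulf_eq0 !mulf_eq0 (negPf u0N0) (negPf u1N0) (negPf sN0) !orbF.
  rewrite subr_eq0 {1}Ep Eq => /eqP E; apply: (mulIf gN0).
  by rewrite mulrAC E mulrA.
have [q1t h1] := H1 t1 st1 u1t1.
have E1 : P.[t1] * q1.[t1] = p1.[t1] * Q.[t1] by rewrite -!hornerM PQ.
have Qt : Q.[t1] != 0.
  apply/negP => Q0; have := coprimep_root cop; move/(_ t1).
  rewrite rootE; have -> : P.[t1] = 0.
    by apply/eqP; move/eqP: E1; rewrite (eqP Q0) mulr0 mulf_eq0 (negPf q1t) orbF.
  by rewrite eqxx (eqP Q0) eqxx => /(_ isT).
by split=> //; rewrite h1; apply/eqP; rewrite eqr_div // E1.
Qed.

(* [A] is a ring of functions on [S] that contains the constants and is closed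
   under patching local quotients, so that regular functions on a variety
   pulled back along a curve with coordinates in [A] stay in [A]. *)
Record regular_ring (S : K -> Prop) (A : (K -> K) -> Prop) : Prop := RegularRing {
  rr_ext : forall f g, (forall t, S t -> f t = g t) -> A f -> A g;
  rr_cst : forall c, A (fun _ => c);
  rr_add : forall f g, A f -> A g -> A (fun t => f t + g t);
  rr_mul : forall f g, A f -> A g -> A (fun t => f t * g t);
  rr_loc : forall h, (forall t0, S t0 -> exists u f g : K -> K,
      [/\ A u, A f, A g, u t0 != 0 &
        forall t, S t -> u t != 0 -> g t != 0 /\ h t = f t / g t]) -> A h }.

Definition laurent (h : K -> K) :=
  exists p k, forall t, t != 0 -> h t = p.[t] / t ^+ k.

(** For the patching condition: the global denominator has no root other than 0, so over an
    algebraically closed field it is a scalar times a power of [t]. *)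
Lemma laurent_ring : regular_ring (fun t => t != 0) laurent.
Proof.
split.
- move=> f g fg [p [k H]]; exists p, k => t t0; rewrite -fg //; exact: H.
- by move=> c; exists c%:P, 0%N => t _; rewrite hornerC expr0 divr1.
- move=> f g [p [k Hf]] [q [l Hg]].
  exists (p * 'X^l + q * 'X^k), (k + l)%N => t t0.
  rewrite Hf // Hg // addf_div ?expf_neq0 // exprD.
  by rewrite !hornerE.
- move=> f g [p [k Hf]] [q [l Hg]]; exists (p * q), (k + l)%N => t t0.
  by rewrite Hf // Hg // mulf_div hornerM exprD.
move=> h loc.
have [||p [q H]] := @rational_local_global 'X h.
- by rewrite polyX_eq0.
- move=> t0; rewrite hornerX => t0N0; have [u [p [q]]] := loc t0 t0N0.
  case=> [[u' [k Hu]] [p' [l Hp]] [q' [m Hq]] ut0 H].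
  exists u', (p' * 'X^m), (q' * 'X^l); split.
    by apply: contraNneq ut0; rewrite Hu // => ->; rewrite mul0r.
  move=> t; rewrite hornerX => tN0 u't.
  have ut : u t != 0 by rewrite Hu // mulf_neq0 // invr_neq0 // expf_neq0.
  have [qt ->] := H t tN0 ut; move: qt; rewrite Hp // Hq // mulf_eq0 => /norP[q't _].
  rewrite !hornerE mulf_neq0 ?expf_neq0 //; split=> //.
  by rewrite invf_div mulf_div [t ^+ l * _]mulrC.
have pq t : t != 0 -> q.[t] != 0 /\ h t = p.[t] / q.[t].
  by move=> t0; apply: H; rewrite hornerX.
have [r Eq] := closed_field_poly_normal q.
have r0 : all (pred1 0) r.
  apply/allP => z zr /=; apply/negPn/negP => /pq [qz _]; move: qz.
  rewrite Eq hornerZ; have -> : (\prod_(z <- r) ('X - z%:P)).[z] = 0.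
    by apply/rootP; rewrite root_prod_XsubC.
  by rewrite mulr0 eqxx.
exists ((lead_coef q)^-1 *: p), (size r) => t t0; have [_ ->] := pq t t0.
rewrite {1}Eq !hornerZ horner_prod.
have -> : \prod_(z <- r) ('X - z%:P).[t] = t ^+ size r.
  elim: r r0 {Eq} => [|z r IH] /=; first by rewrite big_nil.
  by case/andP=> /eqP -> r0; rewrite big_cons IH // hornerXsubC subr0 exprS.
by rewrite invfM mulrCA mulrA.
Qed.

(** The ring K + t^d K[t], the coordinate ring of a curve that is singular for [d > 1]. Regular
    functions of such curves acquire no term t^e with 0 < e < d. For [d = 0] the ring is K[t]. *)
Definition poly_gap d (h : K -> K) :=
  exists c q, forall t, h t = c + t ^+ d * q.[t].

Lemma poly_gapP d h : poly_gap d h -> exists p, forall t, h t = p.[t].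
Proof.
case=> c [q H]; exists (c%:P + 'X^d * q) => t.
by rewrite H !hornerE.
Qed.

(** A function patched from local quotients is a polynomial [p], because its denominator is nowhere
    zero and hence constant. Near 0 it is [v / w] with [v] and [w] in the ring; then t^d divides
    [w (p - h 0)], and [w] is prime to [t] since [w 0] is nonzero, so t^d divides [p - h 0]. *)
Lemma poly_gap_ring d : regular_ring (fun=> True) (poly_gap d).
Proof.
split.
- by move=> f g fg [c [q H]]; exists c, q => t; rewrite -fg.
- by move=> c; exists c, 0 => t; rewrite horner0 mulr0 addr0.
- move=> f g [c [p Hf]] [e [q Hg]]; exists (c + e), (p + q) => t.
  by rewrite Hf Hg addrACA -mulrDr hornerD.
- move=> f g [c [p Hf]] [e [q Hg]].
  exists (c * e), (c *: q + e *: p + 'X^d * (p * q)) => t.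
  by rewrite Hf Hg !hornerE /=; ring.
move=> h loc.
have [|P [Q H]] := @rational_local_global 1 h (oner_neq0 _).
  move=> t0 _; have [u [p [q]]] := loc t0 I.
  case=> /poly_gapP[u' Hu] /poly_gapP[p' Hp] /poly_gapP[q' Hq] ut0 H.
  exists u', p', q'; split=> [|t _]; first by rewrite -Hu.
  by rewrite -Hu => /H; rewrite Hp Hq; apply.
have {}H t : Q.[t] != 0 /\ h t = P.[t] / Q.[t].
  by apply: H; rewrite hornerC oner_neq0.
have [c cN0 EQ] : exists2 c, c != 0 & Q = c%:P.
  have [/size_poly1P //|/closed_rootP [z /rootP Qz]] := boolP (size Q == 1%N).
  by case: (H z) => [+ _]; rewrite Qz eqxx.
pose p := c^-1 *: P.
have hp t : h t = p.[t] by rewrite (H t).2 EQ hornerC hornerZ mulrC.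
case: d loc => [|d] loc; first by exists 0, p => t; rewrite add0r expr0 mul1r.
have [u [v [w]]] := loc 0 I.
case=> /poly_gapP[u' Hu] [a [v' Hv]] [b [w' Hw]] u0 Hloc.
have [w0N0 h0] := Hloc 0 I u0.
have w0 : w 0 = b by rewrite Hw expr0n mul0r addr0.
have v0 : v 0 = a by rewrite Hv expr0n mul0r addr0.
have Ea : h 0 * b = a by rewrite -v0 -w0 h0 divfK.
rewrite w0 in w0N0.
have gap : 'X^(d.+1) %| (p - (h 0)%:P) * (b%:P + 'X^(d.+1) * w').
  have -> : (p - (h 0)%:P) * (b%:P + 'X^(d.+1) * w') =
      'X^(d.+1) * (v' - h 0 *: w').
    apply/eqP; rewrite -subr_eq0; set D := _ - _.
    have /eqP : D * u' = 0.
      apply: poly_eq0_horner => t; rewrite hornerM -Hu.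
      have [->|ut] := eqVneq (u t) 0; first by rewrite mulr0.
      have [wt ht] := Hloc t I ut.
      have E : w t * p.[t] = v t by rewrite -hp ht mulrC divfK.
      suff -> : D.[t] = 0 by rewrite mul0r.
      have -> : D.[t] = w t * p.[t] - v t.
        by rewrite /D !hornerE /= Hw Hv -Ea; ring.
      by rewrite E subrr.
    rewrite mulf_eq0 => /orP[//|/eqP u'0].
    by move: u0; rewrite Hu u'0 horner0 eqxx.
  exact: dvdp_mulr.
have cop : coprimep 'X^(d.+1) (b%:P + 'X^(d.+1) * w').
  apply: coprimep_expl; rewrite -['X]subr0 coprimep_sym coprimep_XsubC.
  by rewrite rootE !hornerE oppr0 expr0n mul0r addr0.
rewrite (Gauss_dvdpl _ cop) in gap.
case/dvdpP: gap => q Eq; exists (h 0), q => t.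
by rewrite hp -(subrK (h 0)%:P p) Eq !hornerE addrC mulrC.
Qed.
End LocalToGlobal.

(** * Algebraic families of polynomials and their images under ind-morphisms *)

Section Families.
Variables (K : closedFieldType) (n : nat).
Variables (S : K -> Prop) (A : (K -> K) -> Prop).
Hypothesis rrA : regular_ring S A.
Local Notation R := {mpoly K[n]}.
Implicit Types (F G : K -> R) (g : K -> NAut K n).

Lemma rr_sum I (r : seq I) (P : pred I) (f : I -> K -> K) :
  (forall i, P i -> A (f i)) -> A (fun t => \sum_(i <- r | P i) f i t).
Proof.
move=> Af; elim: r => [|i r IH].
  by apply: (rr_ext rrA) (rr_cst rrA 0) => t _; rewrite big_nil.
have [Pi|nPi] := boolP (P i); last first.
  by apply: (rr_ext rrA) IH => t _; rewrite big_cons (negPf nPi).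
by apply: (rr_ext rrA) (rr_add rrA (Af i Pi) IH) => t _; rewrite big_cons Pi.
Qed.

Lemma rr_exp (f : K -> K) k : A f -> A (fun t => f t ^+ k).
Proof.
move=> Af; elim: k => [|k IH].
  by apply: (rr_ext rrA) (rr_cst rrA 1) => t _; rewrite expr0.
by apply: (rr_ext rrA) (rr_mul rrA Af IH) => t _; rewrite exprS.
Qed.

Lemma rr_prod I (r : seq I) (f : I -> K -> K) :
  (forall i, A (f i)) -> A (fun t => \prod_(i <- r) f i t).
Proof.
move=> Af; elim: r => [|i r IH].
  by apply: (rr_ext rrA) (rr_cst rrA 1) => t _; rewrite big_nil.
by apply: (rr_ext rrA) (rr_mul rrA (Af i) IH) => t _; rewrite big_cons.
Qed.

Lemma rr_meval d (p : {mpoly K[d]}) (c : K -> 'I_d -> K) :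
  (forall k, A (fun t => c t k)) -> A (fun t => p.@[c t]).
Proof.
move=> Ac; apply: (rr_ext rrA (f := fun t =>
  \sum_(m <- msupp p) p@_m * \prod_i c t i ^+ m i)) => [t _|].
  by rewrite mevalE.
apply: rr_sum => m _; apply: (rr_mul rrA (rr_cst rrA _)).
by apply: rr_prod => i; apply: rr_exp.
Qed.

(** The uniform degree bound places the whole family in one stage of the filtration. *)
Definition fam F := (exists B, forall t, S t -> (msize (F t) <= B)%N) /\
  forall m, A (fun t => (F t)@_m).

Lemma fam_ext F G : (forall t, S t -> F t = G t) -> fam F -> fam G.
Proof.
move=> FG [[B HB] H]; split; first by exists B => t St; rewrite -FG // HB.
by move=> m; apply: (rr_ext rrA) (H m) => t St; rewrite FG.
Qed.

Lemma fam_cst p : fam (fun=> p).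
Proof. by split; [exists (msize p) | move=> m; apply: (rr_cst rrA)]. Qed.

Lemma famD F G : fam F -> fam G -> fam (fun t => F t + G t).
Proof.
move=> [[B HB] HF] [[C HC] HG]; split.
  exists (maxn B C) => t St; apply: leq_trans (msizeD_le _ _) _.
  by rewrite geq_max !leq_max HB // HC // orbT.
by move=> m; apply: (rr_ext rrA) (rr_add rrA (HF m) (HG m)) => t _; rewrite mcoeffD.
Qed.

Lemma famM F G : fam F -> fam G -> fam (fun t => F t * G t).
Proof.
move=> [[B HB] HF] [[C HC] HG]; split.
  exists (B + C)%N => t St; have [->|F0] := eqVneq (F t) 0.
    by rewrite mul0r msize0.
  have [->|G0] := eqVneq (G t) 0; first by rewrite mulr0 msize0.
  rewrite msizeM //; apply: leq_trans (leq_pred _) _.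
  by rewrite leq_add ?HB ?HC.
move=> m; apply: (rr_ext rrA (f := fun t =>
  \sum_(k : 'X_{1..n < (mdeg m).+1, (mdeg m).+1} | m == (k.1 + k.2)%MM)
     (F t)@_k.1 * (G t)@_k.2)) => [t _|]; first by rewrite mcoeffM.
by apply: rr_sum => k _; apply: (rr_mul rrA).
Qed.

Lemma fam_sum I (r : seq I) (F : I -> K -> R) :
  (forall i, fam (F i)) -> fam (fun t => \sum_(i <- r) F i t).
Proof.
move=> HF; elim: r => [|i r IH].
  by apply: fam_ext (fam_cst 0) => t _; rewrite big_nil.
by apply: fam_ext (famD (HF i) IH) => t _; rewrite big_cons.
Qed.

Lemma fam_exp F k : fam F -> fam (fun t => F t ^+ k).
Proof.
move=> HF; elim: k => [|k IH].
  by apply: fam_ext (fam_cst 1) => t _; rewrite expr0.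
by apply: fam_ext (famM HF IH) => t _; rewrite exprS.
Qed.

Lemma fam_prod I (r : seq I) (F : I -> K -> R) :
  (forall i, fam (F i)) -> fam (fun t => \prod_(i <- r) F i t).
Proof.
move=> HF; elim: r => [|i r IH].
  by apply: fam_ext (fam_cst 1) => t _; rewrite big_nil.
by apply: fam_ext (famM (HF i) IH) => t _; rewrite big_cons.
Qed.

Lemma famZ (a : K -> K) p : A a -> fam (fun t => a t *: p).
Proof.
move=> Aa; split; first by exists (msize p) => t _; apply: msizeZ_le.
move=> m; apply: (rr_ext rrA) (rr_mul rrA Aa (rr_cst rrA p@_m)) => t _.
by rewrite mcoeffZ.
Qed.

(** The degree bound on [F] lets [f t (F t)] be expanded as a sum over a finite set of monomials
    that does not depend on [t]. *)
Lemma fam_app (f : K -> {lrmorphism R -> R}) F :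
  (forall i, fam (fun t => f t 'X_i)) -> fam F -> fam (fun t => f t (F t)).
Proof.
move=> Hf [[B HB] HF]; apply: (@fam_ext (fun t =>
  \sum_(m : 'X_{1..n < B}) ((F t)@_m *: 1) * \prod_i f t 'X_i ^+ m i)).
  move=> t St; rewrite [in RHS](mpolywE (HB t St)) rmorph_sum /=.
  apply: eq_bigr => m _; rewrite lrmorphZ -scalerAl mul1r; congr (_ *: _).
  rewrite mpolyXE_id rmorph_prod; apply: eq_bigr => i _.
  by rewrite rmorphXn.
apply: fam_sum => m; apply: famM; first exact/famZ/HF.
by apply: fam_prod => i; apply/fam_exp/Hf.
Qed.

Lemma bound_fin (P : 'I_n -> nat -> Prop) :
    (forall i b c, (b <= c)%N -> P i b -> P i c) ->
  (forall i, exists b, P i b) -> exists b, forall i, P i b.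
Proof.
move=> mono /fin_all_exists [b Hb]; exists (\max_i b i) => i.
exact: mono (leq_bigmax i) (Hb i).
Qed.

(* An ind-morphism maps curves with coordinates in [A] to such curves. *)
Lemma ind_morphism_fam (Phi : NAut K n -> NAut K n) g : ind_morphism Phi ->
    (forall i, fam (fun t => g t 'X_i)) ->
    (forall i, fam (fun t => aut_inv (g t) 'X_i)) ->
  forall i, fam (fun t => Phi (g t) 'X_i).
Proof.
move=> indPhi Hg Hg'.
have [B HB] : exists B, forall i t, S t -> (msize (g t 'X_i) <= B)%N.
  apply: bound_fin => [i b c bc H t /H /leq_trans|i]; first exact.
  exact: (Hg i).1.
have [B' HB'] : exists B, forall i t, S t -> (msize (aut_inv (g t) 'X_i) <= B)%N.
  apply: bound_fin => [i b c bc H t /H /leq_trans|i]; first exact.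
  exact: (Hg' i).1.
pose N := maxn B B'.
have stN t : S t -> nstage N (g t).
  move=> St; split; apply/bigmax_leqP => i _; apply: leq_trans (leq_pred _) _.
    by apply: leq_trans (HB i t St) _; rewrite leq_maxl.
  by apply: leq_trans (HB' i t St) _; rewrite leq_maxr.
have [M [stM reg]] := indPhi N.
have Acoords k : A (fun t => @coords K n N (g t) k).
  rewrite /coords; case: (enum_val k) => [[b i] m] /=.
  by case: b; [apply: (Hg' i).2 | apply: (Hg i).2].
have Acoord (c : coord_index n M) : A (fun t => Defs.coord (Phi (g t)) c).
  apply: (rr_loc rrA) => t0 St0.
  have [u [p [q [u0 H]]]] := reg c (g t0) (stN t0 St0).
  exists (fun t => u.@[@coords K n N (g t)]), (fun t => p.@[@coords K n N (g t)]),
    (fun t => q.@[@coords K n N (g t)]).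
  split=> //; try exact: rr_meval.
  by move=> t St ut; apply: H => //; apply: stN.
move=> i; have HM t : S t -> (msize (Phi (g t) 'X_i) <= M.+1)%N.
  move=> St; have [/bigmax_leqP/(_ i isT) H _] := stM _ (stN t St).
  by rewrite -ltnS in H; apply: leq_trans H; rewrite leqSpred.
split; first by exists M.+1.
move=> m; have [mM|mM] := ltnP (mdeg m) M.+1.
  exact: (Acoord (false, i, BMultinom mM)).
apply: (rr_ext rrA) (rr_cst rrA 0) => t St; apply/esym/memN_msupp_eq0.
exact/msize_mdeg_ge/(leq_trans (HM t St)).
Qed.
End Families.


(** * Bases chosen inside a separating set of vectors *)

Section Bases.
Variable (F : fieldType) (n : nat).

(** Greedy choice: while fewer than [n] independent vectors are found, some nonzero [v] is
    orthogonal to all of them, and an [x] in [V] not orthogonal to [v] is independent of them.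
    Applied over the rationals to weights and over [K] to differentials. *)
Lemma basis_of_separating (V : 'rV[F]_n -> Prop) :
    (forall v : 'rV[F]_n, v != 0 -> exists2 x, V x & x *m v^T != 0) ->
  exists2 M : 'M[F]_n, M \in unitmx & forall i, V (row i M).
Proof.
move=> sep.
suff H k : (k <= n)%N ->
    exists2 M : 'M[F]_(k, n), row_free M & forall i, V (row i M).
  have [M freeM HM] := H n (leqnn n).
  by exists M; rewrite // -row_free_unit.
elim: k => [_|k IH lt_kn].
  exists 0; last by case.
  by apply/row_freeP; exists 0; apply/matrixP => - [].
have [M freeM HM] := IH (ltnW lt_kn).
have kerN0 : kermx M^T != 0.
  rewrite -mxrank_eq0 mxrank_ker mxrank_tr -lt0n subn_gt0.
  by rewrite (eqP freeM).
have /rowV0Pn [v /sub_kermxP vM v0] := kerN0.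
have [x Vx xv] := sep v v0.
rewrite -[k.+1]addn1; exists (col_mx M x).
  apply: inj_row_free => u; rewrite -[u]hsubmxK mul_row_col.
  set u1 := lsubmx u; set u2 := rsubmx u => E.
  have u20 : u2 = 0.
    have : (u1 *m M + u2 *m x) *m v^T = 0 by rewrite E mul0mx.
    have Mv : M *m v^T = 0 by rewrite -[M]trmxK -trmx_mul vM trmx0.
    rewrite mulmxDl -mulmxA Mv mulmx0 add0r -mulmxA.
    rewrite [x *m _]mx11_scalar mul_mx_scalar => /eqP.
    rewrite scaler_eq0 => /orP[/eqP x0|/eqP //].
    by rewrite [x *m _]mx11_scalar x0 -scalemx1 scale0r eqxx in xv.
  rewrite u20 mul0mx addr0 in E; rewrite u20.
  have /eqP := E; rewrite mulmx_free_eq0 // => /eqP ->.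
  by rewrite row_mx0.
move=> i; case: (split_ordP i) => j ->.
  by rewrite -[row _ _]/(row _ _) rowKu.
by rewrite rowKd; have -> : row j x = x by apply/rowP => l; rewrite !mxE ord1.
Qed.
End Bases.

Lemma clear_denominators n (v : 'rV[rat]_n) : exists D : int, D != 0 /\
  exists u : 'rV[int]_n, map_mx intr u = (D%:~R *: v)%R :> 'rV[rat]_n.
Proof.
exists (\prod_j denq (v 0 j)); split.
  by apply/prodf_neq0 => j _; apply: denq_neq0.
exists (\row_j (numq (v 0 j) * \prod_(k | k != j) denq (v 0 k))).
apply/rowP => j; rewrite !mxE [X in _ = X%:~R * _](bigD1 j) //= !intrM.
by rewrite [RHS]mulrAC [_ * v 0 j]mulrC -numqE.
Qed.

(** * Degree bounds, dimension counting, and order of vanishing at the origin *)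

Section Degree.
Variables (K : closedFieldType) (n : nat).
Local Notation R := {mpoly K[n]}.
Implicit Types (p q : R).

Definition degle d p := (msize p <= d.+1)%N.

Lemma degle_mul a b p q : degle a p -> degle b q -> degle (a + b) (p * q).
Proof.
rewrite /degle => pa qb; have [->|p0] := eqVneq p 0; first by rewrite mul0r msize0.
have [->|q0] := eqVneq q 0; first by rewrite mulr0 msize0.
rewrite msizeM // -ltnS prednK; last by rewrite addn_gt0 lt0n msize_poly_eq0 p0.
by apply: leq_trans (leq_add pa qb) _; rewrite addSn addnS.
Qed.

Lemma degle_exp a p k : degle a p -> degle (k * a) (p ^+ k).
Proof.
move=> pa; elim: k => [|k IH]; first by rewrite expr0 /degle msize1.
by rewrite exprS mulSn degle_mul.
Qed.

Lemma degle_prod (I : finType) a (f : I -> R) :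
  (forall i, degle a (f i)) -> degle (#|I| * a) (\prod_i f i).
Proof.
move=> fa; rewrite cardE -big_enum /=.
elim: (enum I) => [|i r IH]; first by rewrite big_nil /degle msize1.
by rewrite big_cons /= mulSn degle_mul.
Qed.

Lemma degle_bound (I : finType) (f : I -> R) : exists d, forall i, degle d (f i).
Proof.
exists (\max_i msize (f i)) => i; apply: leqW; exact: leq_bigmax.
Qed.

Lemma card_bmultinom B : (#|{: 'X_{1..n < B}}| <= B ^ n)%N.
Proof.
have mB (m : 'X_{1..n < B}) i : (m i < B)%N.
  apply: leq_ltn_trans (bmdeg m); rewrite mdegE (bigD1 i) //=; exact: leq_addr.
rewrite -[B in (B ^ _)%N]card_ord -[n in (_ ^ n)%N]card_ord -card_ffun.
apply: (@leq_card _ _ (fun m => [ffun i => Ordinal (mB m i)])) => m m' /ffunP E.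
apply/val_inj/mnmP => i; have := E i; rewrite !ffunE; by case.
Qed.

Lemma linear_dependence (I : finType) (f : I -> R) B :
    (forall i, (msize (f i) <= B)%N) -> (#|{: 'X_{1..n < B}}| < #|I|)%N ->
  exists2 c : I -> K, (exists i, c i != 0) & \sum_i c i *: f i = 0.
Proof.
move=> fB ltBI.
pose M := \matrix_(r < #|I|, s < #|{: 'X_{1..n < B}}|)
  (f (enum_val r))@_(enum_val s : 'X_{1..n < B}).
have kerN0 : kermx M != 0.
  rewrite -mxrank_eq0 mxrank_ker -lt0n subn_gt0.
  exact: leq_ltn_trans (rank_leq_col _) ltBI.
have /rowV0Pn [v /sub_kermxP vM v0] := kerN0.
exists (fun i => v 0 (enum_rank i)).
  have /rV0Pn [r vr] := v0.
  by exists (enum_val r); rewrite enum_valK.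
apply/mpolyP => m; rewrite raddf_sum mcoeff0 /=.
have [mB|mB] := ltnP (mdeg m) B; last first.
  rewrite big1 // => i _; rewrite mcoeffZ memN_msupp_eq0 ?mulr0 //.
  exact/msize_mdeg_ge/(leq_trans (fB i)).
transitivity ((v *m M) 0 (enum_rank (BMultinom mB))); last by rewrite vM mxE.
rewrite mxE (reindex (@enum_val I xpredT)) /=; last exact: onW_bij (enum_val_bij I).
by apply: eq_bigr => r _; rewrite mcoeffZ enum_valK !mxE enum_rankK.
Qed.

(** The k-th power of the maximal ideal of the origin, expressed through coefficients. *)
Definition ordge k p := forall m, (mdeg m < k)%N -> p@_m = 0.

Lemma ordge0 p : ordge 0 p. Proof. by []. Qed.

Lemma ordge_cst k : ordge k (0 : R). Proof. by move=> m _; rewrite mcoeff0. Qed.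

Lemma ordgeD k p q : ordge k p -> ordge k q -> ordge k (p + q).
Proof. by move=> Hp Hq m mk; rewrite mcoeffD Hp // Hq // addr0. Qed.

Lemma ordgeZ k c p : ordge k p -> ordge k (c *: p).
Proof. by move=> Hp m mk; rewrite mcoeffZ Hp // mulr0. Qed.

Lemma ordgeB k p q : ordge k p -> ordge k q -> ordge k (p - q).
Proof. by move=> Hp Hq m mk; rewrite mcoeffB Hp // Hq // subr0. Qed.

Lemma ordge_sum k I (r : seq I) (P : pred I) (f : I -> R) :
  (forall i, P i -> ordge k (f i)) -> ordge k (\sum_(i <- r | P i) f i).
Proof. by move=> Hf m mk; rewrite raddf_sum big1 //= => i Pi; apply: Hf. Qed.

Lemma ordge_leq k l p : (k <= l)%N -> ordge l p -> ordge k p.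
Proof. by move=> kl Hp m mk; apply: Hp; apply: leq_trans kl. Qed.

Lemma ordgeM k l p q : ordge k p -> ordge l q -> ordge (k + l) (p * q).
Proof.
move=> Hp Hq m mkl; rewrite mcoeffM big1 // => -[m1 m2] /= /eqP E.
have [m1k|m1k] := ltnP (mdeg m1) k; first by rewrite Hp ?mul0r.
rewrite Hq ?mulr0 // -(ltn_add2l (mdeg m1)) -mdegD -E.
by apply: leq_trans mkl _; rewrite leq_add2r.
Qed.

Lemma ordge_neq0 p : p != 0 -> exists k, ~ ordge k p.
Proof.
rewrite -msupp_eq0; case E: (msupp p) => [//|m s] _.
exists (mdeg m).+1 => /(_ m (ltnSn _)) /eqP; rewrite mcoeff_eq0.
by rewrite E inE eqxx.
Qed.

Lemma ordge_eq0 p : (forall k, ordge k p) -> p = 0.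
Proof.
by move=> H; apply/eqP/negPn/negP => /ordge_neq0 [k]; apply; apply: H.
Qed.

(* [p] and [q] have order at least [a] and the same part of degree [a] *)
Definition cong a p q := [/\ ordge a p, ordge a q & ordge a.+1 (p - q)].

Lemma congM a b p q p' q' : cong a p q -> cong b p' q' ->
  cong (a + b) (p * p') (q * q').
Proof.
move=> [Hp Hq Hpq] [Hp' Hq' Hpq']; split; try exact: ordgeM.
have -> : p * p' - q * q' = (p - q) * p' + q * (p' - q').
  by rewrite mulrBl mulrBr addrA subrK.
by apply: ordgeD; [rewrite -addSn | rewrite -addnS]; apply: ordgeM.
Qed.

Lemma cong_exp a p q k : cong a p q -> cong (k * a) (p ^+ k) (q ^+ k).
Proof.
move=> H; elim: k => [|k IH].
  by rewrite !expr0; split; rewrite ?subrr //; apply: ordge_cst.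
by rewrite !exprS mulSn; apply: congM.
Qed.

Lemma cong_prod (r : seq 'I_n) (m : 'I_n -> nat) (f g : 'I_n -> R) :
    (forall i, cong 1 (f i) (g i)) ->
  cong (\sum_(i <- r) m i) (\prod_(i <- r) f i ^+ m i)
    (\prod_(i <- r) g i ^+ m i).
Proof.
move=> H; elim: r => [|i r IH].
  by rewrite !big_nil; split; rewrite ?subrr //; apply: ordge_cst.
rewrite !big_cons; apply: congM => //.
by have := cong_exp (m i) (H i); rewrite muln1.
Qed.

(** A substitution tangent to the identity at the origin preserves leading forms: it changes a
    monomial only by terms of higher degree. *)
Lemma ordge_subst k p (f : {lrmorphism R -> R}) :
    (forall i, ordge 2 (f 'X_i - 'X_i)) -> ordge k p ->
  ordge k.+1 (f p - p) /\ ordge k (f p).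
Proof.
move=> Hf Hp.
have Hc i : cong 1 (f 'X_i) 'X_i.
  have HX : ordge 1 ('X_i : R).
    move=> m; rewrite ltnS leqn0 mdeg_eq0 => /eqP ->.
    by rewrite mcoeffX -[(_ == _)]/(_ == _) mnm1_eq0.
  split=> //.
  by rewrite -(subrK 'X_i (f 'X_i)); apply: ordgeD => //; apply: ordge_leq (Hf i).
suff H : ordge k.+1 (f p - p).
  split=> //; rewrite -(subrK p (f p)); apply: ordgeD => //.
  exact: ordge_leq H.
rewrite lrmorph_mpolyE {3}[p]mpolyE -sumrB big_seq; apply: ordge_sum => m.
rewrite -scalerBr mpolyXE_id => mp; apply: ordgeZ.
have km : (k <= mdeg m)%N.
  by rewrite leqNgt; apply: contraL mp => /Hp; rewrite mcoeff_msupp => ->; rewrite eqxx.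
have [_ _ +] := cong_prod (index_enum _) m Hc.
by apply: ordge_leq; rewrite ltnS; rewrite mdegE in km.
Qed.
End Degree.

(** * Gradings by Z^n whose weights have rank n *)

Section Grading.
Variables (K : closedFieldType) (n : nat).
Local Notation R := {mpoly K[n]}.
Local Notation W := 'rV[int]_n.
Implicit Types (p q f g : R) (w : W).

Definition sum_wt (s : seq (W * R)) : R := \sum_(x <- s) x.2.

(** [wt w f] reads: [f] is homogeneous of weight [w] for an algebra grading by Z^n, in other words
    for an action of an n-dimensional torus. [wt_indep] is directness of the sum; [wt_full] says
    that no nontrivial one-parameter subgroup, given by [v], acts trivially. *)
Record full_grading (wt : W -> R -> Prop) : Prop := FullGrading {
  wt_0 : forall w, wt w 0;
  wt_add : forall w f g, wt w f -> wt w g -> wt w (f + g);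
  wt_scale : forall w c f, wt w f -> wt w (c *: f);
  wt_one : wt 0 1;
  wt_mul : forall w w' f g, wt w f -> wt w' g -> wt (w + w') (f * g);
  wt_indep : forall w f (s : seq (W * R)), wt w f ->
    (forall x, x \in s -> x.1 != w /\ wt x.1 x.2) -> f = sum_wt s -> f = 0;
  wt_dec : forall p, exists2 s : seq (W * R),
    (forall x, x \in s -> wt x.1 x.2) & p = sum_wt s;
  wt_full : forall v : W, (forall w f, wt w f -> f != 0 ->
    \sum_j w 0 j * v 0 j = 0) -> v = 0 }.

Variable wt : W -> R -> Prop.
Hypothesis grW : full_grading wt.

Lemma wt_sum w I (r : seq I) (P : pred I) (f : I -> R) :
  (forall i, P i -> wt w (f i)) -> wt w (\sum_(i <- r | P i) f i).
Proof.
by move=> Hf; apply: big_ind => //; [exact: (wt_0 grW) | exact: (wt_add grW)].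
Qed.

Lemma wt_exp w f k : wt w f -> wt (w *+ k) (f ^+ k).
Proof.
move=> wf; elim: k => [|k IH]; first exact: (wt_one grW).
by rewrite exprS mulrS; apply: (wt_mul grW).
Qed.

Lemma wt_prod (r : seq 'I_n) (w : 'I_n -> W) (f : 'I_n -> R) (m : 'I_n -> nat) :
    (forall i, wt (w i) (f i)) ->
  wt (\sum_(i <- r) w i *+ m i) (\prod_(i <- r) f i ^+ m i).
Proof.
move=> wf; elim: r => [|i r IH]; first by rewrite !big_nil; apply: (wt_one grW).
by rewrite !big_cons; apply: (wt_mul grW) => //; apply: wt_exp.
Qed.

Lemma wt_opp w f : wt w f -> wt w (- f).
Proof. by rewrite -scaleN1r; apply: (wt_scale grW). Qed.

Lemma wt_inj_eq0 (I : finType) (w : I -> W) (f : I -> R) : injective w ->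
  (forall i, wt (w i) (f i)) -> \sum_i f i = 0 -> forall i, f i = 0.
Proof.
move=> winj wf f0 i.
apply: (wt_indep grW (s := [seq (w j, - f j) | j <- enum (predC1 i)]) (wf i)).
  move=> x /mapP [j]; rewrite mem_enum inE => ji -> /=.
  by split; [rewrite (inj_eq winj) | apply: wt_opp].
rewrite /sum_wt big_map big_enum /= sumrN; apply/eqP.
by move: f0; rewrite (bigD1 i) //= => /eqP; rewrite addr_eq0.
Qed.

(* Splits a relation between sums of weight vectors along the weight [w]. *)
Lemma wt_component w f (s : seq (W * R)) : wt w f ->
    (forall x, x \in s -> wt x.1 x.2) -> f = sum_wt s ->
  f = \sum_(x <- s | x.1 == w) x.2.
Proof.
move=> wf ws fs; apply/eqP; rewrite -subr_eq0; apply/eqP.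
apply: (wt_indep grW (w := w) (s := [seq x <- s | x.1 != w])).
- apply: (wt_add grW) => //; apply: wt_opp; rewrite big_seq_cond.
  by apply: wt_sum => x /andP[/ws xs /eqP <-].
- by move=> x; rewrite mem_filter => /andP[xw /ws].
rewrite fs {1}/sum_wt (bigID (fun x => x.1 == w)) /= addrAC subrr add0r.
by rewrite /sum_wt big_filter.
Qed.

Lemma intZ_mulrn w (k : nat) : k%:Z *: w = w *+ k.
Proof. by apply/rowP => j; rewrite mxE mulmxnE -mulr_natl natz. Qed.

(** The weights separate rational vectors: one orthogonal to all of them would, after clearing
    denominators, contradict [wt_full]. *)
Lemma exists_independent_weights : exists f : 'I_n -> R, exists w : 'I_n -> W,
  (forall i, f i != 0 /\ wt (w i) (f i)) /\
  (forall a : W, \sum_i a 0 i *: w i = 0 -> a = 0).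
Proof.
pose V (x : 'rV[rat]_n) :=
  exists w f, [/\ wt w f, f != 0 & x = map_mx intr w].
have [v v0|M Munit HM] := @basis_of_separating rat n V.
  have [D [D0 [u Eu]]] := clear_denominators v.
  apply: NNPP => H; move: v0; apply/negP; rewrite negbK.
  suff u0 : u = 0.
    move/esym/eqP: Eu; rewrite u0 map_mx0 scaler_eq0 intr_eq0.
    by rewrite (negPf D0).
  apply: (wt_full grW) => w f wf f0; apply/eqP/negPn/negP => wu.
  apply: H; exists (map_mx intr w); first by exists w, f.
  apply/negP => /eqP /rowP /(_ 0); rewrite !mxE => E.
  move: wu; rewrite -(intr_eq0 rat) rmorph_sum /=.
  rewrite (eq_bigr (fun j => D%:~R * (map_mx intr w 0 j * v^T j 0))).
    by rewrite -mulr_sumr E mulr0 eqxx.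
  move=> j _; move/rowP/(_ j): Eu; rewrite !mxE rmorphM /= => ->.
  by rewrite mulrCA.
have /fin_all_exists [w /fin_all_exists [f H]] := HM.
exists f, w; split=> [i|a]; first by have [] := H i.
move=> E; apply/rowP => j; apply/eqP; rewrite !mxE -(intr_eq0 rat).
have : map_mx intr a *m M = 0.
  transitivity (map_mx intr (\sum_i a 0 i *: w i) : 'rV[rat]_n).
    2: by rewrite E map_mx0.
  rewrite mulmx_sum_row map_mx_sum; apply: eq_bigr => i _.
  by have [_ _ ->] := H i; rewrite map_mxZ !mxE.
move/eqP; rewrite mulmx_free_eq0 ?row_free_unit // => /eqP /rowP /(_ j).
by rewrite !mxE => ->.
Qed.

(* A binary form in [f] and [g] splits into linear factors. *)
Lemma binary_form_eq0 D (p : {poly K}) f g :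
    p != 0 -> (size p <= D.+1)%N -> g != 0 ->
    \sum_(i < D.+1) p`_i *: (f ^+ i * g ^+ (D - i)) = 0 ->
  exists r, f = r *: g.
Proof.
elim: D p => [|D IH] p p0 sp g0 E.
  move: E; rewrite big_ord1 !expr0 mulr1 => /eqP.
  rewrite scaler_eq0 oner_eq0 orbF => /eqP pc; move: p0.
  by rewrite (size1_polyC sp) pc eqxx.
have [sp1|sp1] := leqP (size p) 1.
  move: E; rewrite big_ord_recl big1 => [|i _]; last first.
    by rewrite nth_default ?scale0r // (leq_trans sp1).
  rewrite addr0 expr0 mul1r => /eqP; rewrite scaler_eq0 expf_eq0 (negPf g0).
  by rewrite andbF orbF => /eqP pc; move: p0; rewrite (size1_polyC sp1) pc eqxx.
have /closed_rootP [r /factor_theorem [q Eq]] : size p != 1%N.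
  by rewrite neq_ltn sp1 orbT.
have q0 : q != 0 by apply: contraNneq p0 => qz; rewrite Eq qz mul0r.
have sq : (size q <= D.+1)%N by move: sp; rewrite Eq size_Mmonic ?monicXsubC // size_XsubC addn2.
have : (f - r *: g) * \sum_(i < D.+1) q`_i *: (f ^+ i * g ^+ (D - i)) = 0.
  rewrite -[RHS]E Eq mulrBr [LHS]mulrBl; under [RHS]eq_bigr do rewrite coefB scalerBl.
  rewrite sumrB; congr (_ - _).
    rewrite [RHS]big_ord_recl coefMX eqxx scale0r add0r mulr_sumr.
    apply: eq_bigr => i _; rewrite coefMX /= -scalerAr; congr (_ *: _).
    by rewrite mulrA -exprS subSS.
  rewrite [RHS]big_ord_recr /= coefMC nth_default // mul0r scale0r addr0 mulr_sumr.
  apply: eq_bigr => i _; rewrite coefMC -scalerAl -scalerAr scalerA mulrC.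
  by congr (_ *: _); rewrite mulrCA -exprS subSn // -ltnS.
move/eqP; rewrite mulf_eq0 subr_eq0 => /orP[/eqP ->|/eqP]; first by exists r.
exact: IH.
Qed.

(** Otherwise [f / g] and [n] vectors [F i] of independent weights would be [n + 1] algebraically
    independent elements. In effective form: the products [f^i g^(D-i) F^a] outnumber the monomials
    of their degree, and a linear relation among them splits by weight into binary forms in [f] and
    [g]. *)
Lemma wt_line w f g : wt w f -> wt w g -> g != 0 -> exists c, f = c *: g.
Proof.
move=> wf wg g0.
have [F [wF [HF indep]]] := exists_independent_weights.
have [d Hd] : exists d, [/\ degle d f, degle d g & forall i, degle d (F i)].
  have [d Hd] := degle_bound F; exists (maxn d (maxn (msize f) (msize g))).
  split=> [||i]; try by apply: leqW; rewrite !leq_max leqnn ?orbT.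
  by apply: leq_trans (Hd i) _; rewrite ltnS leq_max leqnn.
have [df dg dF] := Hd.
(* With this [D] there are at most [(((n+1) d + 1) D)^n = D^(n+1)] monomials of degree at most
   [(n+1) d D], against [(D+1) D^n] products. *)
pose D := (((n.+1 * d).+1) ^ n)%N.
have D0 : (0 < D)%N by rewrite expn_gt0.
pose I := ('I_D.+1 * {ffun 'I_n -> 'I_D})%type.
pose e (x : I) := f ^+ x.1 * g ^+ (D - x.1) * \prod_i F i ^+ x.2 i.
have [||c [[i0 a0] c0] Ec] := @linear_dependence K n I e (n.+1 * d * D).+1.
- case=> i a; rewrite /e /=.
  have H1 : degle (D * d) (f ^+ i * g ^+ (D - i)).
    have -> : (D * d = i * d + (D - i) * d)%N by rewrite -mulnDl subnKC // -ltnS.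
    by apply: degle_mul; apply: degle_exp.
  have H2 : degle (n * (D * d)) (\prod_i F i ^+ a i).
    rewrite -[n in (n * _)%N]card_ord; apply: degle_prod => j.
    apply: leq_trans (degle_exp _ (dF j)) _.
    by rewrite ltnS leq_mul2r ltnW ?orbT.
  have := degle_mul H1 H2; rewrite /degle -mulSn; congr (_ <= _.+1)%N.
  by rewrite mulnCA mulnC.
- apply: leq_ltn_trans (card_bmultinom _ _) _.
  rewrite card_prod card_ffun !card_ord.
  apply: (@leq_ltn_trans (D * D ^ n)); last by rewrite ltn_pmul2r ?expn_gt0 ?D0.
  by rewrite -expnMn; case: (n) => // k; rewrite leq_exp2r // mulSn -addn1 addnC leq_add.
pose h (a : {ffun 'I_n -> 'I_D}) := \sum_(i < D.+1) c (i, a) *: (f ^+ i * g ^+ (D - i)).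
pose wa (a : {ffun 'I_n -> 'I_D}) := w *+ D + \sum_i wF i *+ a i.
have Eh : \sum_a h a * \prod_i F i ^+ a i = 0.
  rewrite -[RHS]Ec; under [LHS]eq_bigr => a _ do rewrite /h mulr_suml.
  rewrite exchange_big pair_big /=; apply: eq_bigr => -[i a] _ /=.
  by rewrite /e /= -scalerAl.
(* Distinct exponents [a] give distinct weights, so the relation holds for each [a] separately. *)
have wa_inj : injective wa.
  move=> a b /addrI /eqP; rewrite -subr_eq0 -sumrB => /eqP Eab.
  have : \row_i ((a i)%:Z - (b i)%:Z) = 0 :> W.
    apply: indep; rewrite -[RHS]Eab; apply: eq_bigr => i _.
    by rewrite mxE scalerBl !intZ_mulrn.
  move=> /rowP E; apply/ffunP => i; apply/val_inj.
  by have /eqP := E i; rewrite !mxE subr_eq0 => /eqP [].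
have wh a : wt (wa a) (h a * \prod_i F i ^+ a i).
  apply: (wt_mul grW); last by apply: wt_prod => i; case: (HF i).
  apply: wt_sum => i _; apply: (wt_scale grW).
  have -> : w *+ D = w *+ i + w *+ (D - i) by rewrite -mulrnDr subnKC // -ltnS.
  by apply: (wt_mul grW); apply: wt_exp.
have /eqP := wt_inj_eq0 wa_inj wh Eh a0.
have -> : h a0 * \prod_i F i ^+ a0 i == 0 = (h a0 == 0).
  rewrite mulf_eq0 orbC; case: eqP => // /eqP; rewrite prodf_seq_eq0.
  by case/hasP=> i _ /=; rewrite expf_eq0 (negPf (HF i).1) andbF.
move=> /eqP h0; apply: (@binary_form_eq0 D (\poly_(i < D.+1) c (inord i, a0))) => //.
  apply: contraNneq c0 => /polyP /(_ i0); rewrite coef_poly ltn_ord inord_val.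
  by rewrite coef0 => ->.
by rewrite -[RHS]h0; apply: eq_bigr => i _; rewrite coef_poly ltn_ord inord_val.
Qed.

Lemma wt0_cst f : wt 0 f -> exists c, f = c%:MP.
Proof.
move=> /wt_line /(_ (wt_one grW) (oner_neq0 _)) [c ->]; exists c.
by rewrite -alg_mpolyC.
Qed.

Lemma wt_cst w c : w != 0 -> wt w c%:MP -> c = 0.
Proof.
move=> w0 wc; apply/eqP; rewrite -(mpolyC_eq0 n); apply/eqP.
apply: (wt_indep grW (s := [:: (0, c%:MP)]) wc); last by rewrite /sum_wt big_seq1.
move=> x; rewrite inE => /eqP -> /=; rewrite eq_sym; split=> //.
by rewrite -alg_mpolyC; apply: (wt_scale grW); apply: (wt_one grW).
Qed.

(* Otherwise [f] would be a nonconstant unit. *)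
Lemma wt_mul_eq0 w w' f g : wt w f -> wt w' g -> w != 0 -> w + w' = 0 -> f * g = 0.
Proof.
move=> wf wg w0 E; have := wt_mul grW wf wg; rewrite E => /wt0_cst [c Ec].
have [c0|c0] := eqVneq c 0; first by rewrite Ec c0.
have : f \is a GRing.unit.
  apply/unitrP; exists (c^-1 *: g).
  by rewrite -scalerAl -scalerAr mulrC Ec -mul_mpolyC -mpolyCM mulVf.
case/andP=> /eqP Ef _; rewrite Ef in wf; have := wt_cst w0 wf => f0.
by rewrite Ef f0 mpolyC0 mul0r.
Qed.

End Grading.

(** * The fixed point and the filtration by powers of its ideal *)

Section Linearization.
Variables (K : closedFieldType) (n : nat).
Local Notation R := {mpoly K[n]}.
Local Notation W := 'rV[int]_n.
Implicit Types (p q f g P Q : R) (w : W) (C : W * R -> Prop).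

Definition span C P := exists2 s : seq (W * R), (forall x, x \in s -> C x) &
  P = sum_wt s.

Lemma span0 C : span C 0.
Proof. by exists [::]; rewrite // /sum_wt big_nil. Qed.

Lemma spanD C P Q : span C P -> span C Q -> span C (P + Q).
Proof.
move=> [s Hs ->] [t Ht ->]; exists (s ++ t); last by rewrite /sum_wt big_cat.
by move=> x; rewrite mem_cat => /orP[/Hs|/Ht].
Qed.

Lemma span_sum C I (r : seq I) (D : pred I) (f : I -> R) :
  (forall i, D i -> span C (f i)) -> span C (\sum_(i <- r | D i) f i).
Proof. by move=> Hf; apply: big_ind => //; [apply: span0 | apply: spanD]. Qed.

Lemma span1 C x : C x -> span C x.2.
Proof.
move=> Cx; exists [:: x]; last by rewrite /sum_wt big_seq1.
by move=> y; rewrite inE => /eqP ->.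
Qed.

Lemma span_sub C C' P : (forall x, C x -> C' x) -> span C P -> span C' P.
Proof. by move=> sub [s Hs ->]; exists s => // x /Hs /sub. Qed.

Lemma spanM C C' C'' P Q : (forall x y, C x -> C' y -> span C'' (x.2 * y.2)) ->
  span C P -> span C' Q -> span C'' (P * Q).
Proof.
move=> H [s Hs ->] [t Ht ->]; rewrite /sum_wt mulr_suml big_seq.
apply: span_sum => x xs; rewrite mulr_sumr big_seq; apply: span_sum => y yt.
by apply: H; [apply: Hs | apply: Ht].
Qed.

Lemma spanZ C c P : (forall x, C x -> C (x.1, c *: x.2)) -> span C P ->
  span C (c *: P).
Proof.
move=> H [s Hs ->]; rewrite /sum_wt scaler_sumr big_seq; apply: span_sum => x xs.
exact: (span1 (H x (Hs x xs))).
Qed.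

Variable wt : W -> R -> Prop.
Hypothesis grW : full_grading wt.

Definition is_wt (x : W * R) := wt x.1 x.2.
(** The span of these vectors, [maxid], is the maximal ideal of a fixed point of the torus: it is an
    ideal by [wt_mul_eq0], and of codimension 1 because only constants have weight 0. *)
Definition nonzero_wt (x : W * R) := x.1 != 0 /\ wt x.1 x.2.
Local Notation maxid := (span nonzero_wt).

Lemma span_wt P : span is_wt P.
Proof. by have [s] := wt_dec grW P; exists s. Qed.

Lemma maxidM P Q : maxid P -> maxid (P * Q).
Proof.
move=> MP; apply: spanM MP (span_wt Q) => x y [x0 wx] wy.
have [E|N0] := eqVneq (x.1 + y.1) 0.
  by rewrite (wt_mul_eq0 grW wx wy x0 E); apply: span0.
apply: (span1 (x := (x.1 + y.1, x.2 * y.2))); split=> //.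
exact: (wt_mul grW).
Qed.

Lemma maxidZ c P : maxid P -> maxid (c *: P).
Proof. by rewrite -mul_mpolyC mulrC; apply: maxidM. Qed.

Lemma maxid_wt0 f : maxid f -> wt 0 f -> f = 0.
Proof. by move=> [s Hs Ef] wf; apply: (wt_indep grW wf Hs). Qed.

Lemma wt0C c : wt 0 c%:MP.
Proof. by rewrite -alg_mpolyC; apply: (wt_scale grW); apply: (wt_one grW). Qed.

Lemma maxid_codim1 P : exists c, maxid (P - c%:MP).
Proof.
have [s Hs ->] := span_wt P; elim: s Hs => [|x s IH] Hs.
  by exists 0; rewrite /sum_wt big_nil subrr; apply: span0.
have [|c Hc] := IH; first by move=> y ys; apply: Hs; rewrite inE ys orbT.
have wx : is_wt x by apply: Hs; rewrite mem_head.
rewrite /sum_wt big_cons -/(sum_wt s).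
have [x0|x0] := eqVneq x.1 0.
  move: wx; rewrite /is_wt x0 => /(wt0_cst grW) [d ->]; exists (d + c).
  by rewrite mpolyCD opprD addrACA subrr add0r.
exists c; rewrite -addrA; apply: spanD Hc.
exact: span1.
Qed.

Variable a : 'I_n -> K.
Hypothesis Ha : forall i, maxid ('X_i - (a i)%:MP).
Local Notation tau := (transl a).

Lemma tauX0 i : (tau 'X_i)@_0 = a i.
Proof. by rewrite translX mcoeffD mcoeffX mcoeffC mnm1_eq0 eqxx add0r mulr1. Qed.

(** Modulo [maxid] each variable is congruent to [a i], hence each polynomial to its value at [a],
    which is the constant term of [tau P]. *)
Lemma maxid_eval P : maxid (P - ((tau P)@_0)%:MP).
Proof.
pose G P := maxid (P - ((tau P)@_0)%:MP).
have GC c : G c%:MP by rewrite /G autC mcoeffC eqxx mulr1 subrr; apply: span0.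
have GD p q : G p -> G q -> G (p + q).
  rewrite /G lrmorphD mcoeffD mpolyCD opprD addrACA; exact: spanD.
have GM p q : G p -> G q -> G (p * q).
  move=> Gp Gq; rewrite /G lrmorphM rmorphM /= mpolyCM.
  set c := ((tau p)@_0)%:MP; set d := (_ @_ _)%:MP.
  have -> : p * q - c * d = (p - c) * q + (q - d) * c by ring.
  by apply: spanD; apply: maxidM.
have GX i : G 'X_i by rewrite /G tauX0.
rewrite -/(G P) [P]mpolyE.
apply: big_ind; [exact: (GC 0) | exact: GD | move=> m _].
rewrite -mul_mpolyC mpolyXE_id; apply: (GM) => //.
apply: big_ind; [exact: (GC 1) | exact: GM | move=> i _].
by elim: (m i) => [|k IH]; rewrite ?expr0 ?exprS; [exact: (GC 1) | exact: GM].
Qed.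

Lemma wt_eval w f : wt w f -> w != 0 -> (tau f)@_0 = 0.
Proof.
move=> wf w0; apply/eqP; rewrite -(mpolyC_eq0 n); apply/eqP.
apply: maxid_wt0; last exact: wt0C.
have -> : ((tau f)@_0)%:MP = f + -1 *: (f - ((tau f)@_0)%:MP) :> R.
  by rewrite scaleN1r opprB addrC subrK.
apply: spanD; first exact: (span1 (x := (w, f))).
apply/maxidZ/maxid_eval.
Qed.

Definition wt_ord k (x : W * R) := wt x.1 x.2 /\ ordge k (tau x.2).

Lemma maxid_ord1 P : maxid P -> span (wt_ord 1) P.
Proof.
apply: span_sub => x [x0 wx]; split=> // m; rewrite ltnS leqn0 mdeg_eq0 => /eqP ->.
exact: wt_eval wx x0.
Qed.

Lemma wt_ordM k l P Q : span (wt_ord k) P -> span (wt_ord l) Q ->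
  span (wt_ord (k + l)) (P * Q).
Proof.
apply: spanM => x y [wx ox] [wy oy].
apply: (span1 (x := (x.1 + y.1, x.2 * y.2))); split; first exact: (wt_mul grW).
by rewrite /= lrmorphM; apply: ordgeM.
Qed.

Lemma wt_ord_cst : span (wt_ord 0) 1.
Proof. by apply: (span1 (x := (0, 1))); split; [apply: (wt_one grW) | ]. Qed.

Lemma wt_ordZ k c P : span (wt_ord k) P -> span (wt_ord k) (c *: P).
Proof.
apply: spanZ => x [wx ox]; split; first exact: (wt_scale grW).
by rewrite lrmorphZ; apply: ordgeZ.
Qed.

(* The powers of the maximal ideal of the fixed point are graded. *)
Lemma graded_pow k P : ordge k (tau P) -> span (wt_ord k) P.
Proof.
move=> HP; have -> : P = aut_inv tau (tau P) by rewrite /= aut_funK.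
rewrite [X in aut_inv tau X]mpolyE rmorph_sum big_seq; apply: span_sum => m mP.
rewrite /= [X in span _ X]lrmorphZ; apply: wt_ordZ.
have km : (k <= mdeg m)%N.
  by rewrite leqNgt; apply: contraL mP => /HP; rewrite mcoeff_msupp => ->; rewrite eqxx.
apply: (span_sub (C := wt_ord (mdeg m))) => [x [wx ox]|].
  by split=> //; apply: ordge_leq ox.
rewrite mpolyXE_id mdegE rmorph_prod.
elim: (index_enum _) => [|i r IH]; first by rewrite !big_nil; apply: wt_ord_cst.
rewrite !big_cons; apply: wt_ordM => //; rewrite rmorphXn.
elim: (m i) => [|l IHl]; first by rewrite expr0; apply: wt_ord_cst.
rewrite exprS -add1n; apply: wt_ordM => //.
rewrite -[X in span _ X]/(aut_inv tau 'X_i) transl_invX.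
exact: maxid_ord1.
Qed.

(** The weight components of ['X_i - a i] vanish at [a] and their differentials span the cotangent
    space there, so [n] weight vectors with independent differentials can be chosen. The matrix is
    their Jacobian at [a]. *)
Lemma exists_wt_coordinates : exists y : 'I_n -> R, exists w : 'I_n -> W,
  (forall i, wt (w i) (y i) /\ (tau (y i))@_0 = 0) /\
  \matrix_(i, j) (tau (y i))@_U_(j) \in unitmx.
Proof.
pose lin f : 'rV[K]_n := \row_j (tau f)@_U_(j).
pose V x := exists w f, [/\ wt w f, (tau f)@_0 = 0 & x = lin f].
have [v v0|J Junit HJ] := @basis_of_separating K n V.
  apply: NNPP => H; move: v0; apply/negP; rewrite negbK; apply/eqP/rowP => i.
  rewrite mxE; have [s Hs Es] := Ha i.
  have linv f : lin f *m v^T = (\sum_j (tau f)@_U_(j) * v 0 j)%:M.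
    rewrite [LHS]mx11_scalar; congr (_%:M); rewrite mxE.
    by apply: eq_bigr => j _; rewrite !mxE.
  have Hf w f : wt w f -> w != 0 -> \sum_j (tau f)@_U_(j) * v 0 j = 0.
    move=> wf w0; apply/eqP/negPn/negP => N0; apply: H.
    exists (lin f); first by exists w, f; split=> //; apply: wt_eval wf w0.
    rewrite linv; apply: contraNneq N0 => /matrixP /(_ 0 0).
    by rewrite !mxE eqxx mulr1n => ->.
  have E : \sum_j (tau ('X_i - (a i)%:MP))@_U_(j) * v 0 j = v 0 i.
    rewrite lrmorphB translX autC addrK (bigD1 i) //= big1 => [|j ji].
      by rewrite mcoeffXU eqxx mul1r addr0.
    by rewrite mcoeffXU eq_sym (negPf ji) mul0r.
  rewrite -E Es /sum_wt rmorph_sum.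
  under eq_bigr do rewrite raddf_sum mulr_suml.
  rewrite exchange_big /= big_seq big1 // => x xs.
  by have [x0 wx] := Hs x xs; apply: Hf wx x0.
have /fin_all_exists [w /fin_all_exists [y H]] := HJ.
exists y, w; split=> [i|]; first by have [] := H i.
congr (_ \in unitmx): Junit; apply/row_matrixP => i; have [_ _ ->] := H i.
by apply/rowP => j; rewrite !mxE.
Qed.

End Linearization.

(** * Weight vectors as global coordinates *)

Section LinearizationTheorem.
Variables (K : closedFieldType) (n : nat).
Local Notation R := {mpoly K[n]}.
Local Notation W := 'rV[int]_n.
Implicit Types (p q f g P Q : R).
Variable wt : W -> R -> Prop.
Hypothesis grW : full_grading wt.

Section Coordinates.
Variables (a : 'I_n -> K) (y : 'I_n -> R) (w : 'I_n -> W).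
Hypothesis Ha : forall i, span (nonzero_wt wt) ('X_i - (a i)%:MP).
Local Notation tau := (transl a).
Hypothesis wy : forall i, wt (w i) (y i).
Hypothesis y0 : forall i, (tau (y i))@_0 = 0.
Let J := \matrix_(i, j) (tau (y i))@_U_(j).
Hypothesis Junit : J \in unitmx.

(** The [y i] are formal coordinates at [a]. An error [g] of order [k] is corrected by substituting
    [J^-1 y] for the variables in [tau g]; after translation this substitution is tangent to the
    identity, so [ordge_subst] gains one order. *)
Lemma approx_subst k P : exists Q, ordge k (tau (P - subst y Q)).
Proof.
pose y' j := \sum_i invmx J j i *: y i.
have Hy' i : ordge 2 (subst (tau \o y') 'X_i - 'X_i).
  move=> m; rewrite substX /= ltnS leq_eqVlt ltnS leqn0 => /orP[|].
    case/mdeg1P=> j /eqP ->; rewrite mcoeffB mcoeffXU rmorph_sum raddf_sum /=.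
    have -> : \sum_k (tau (invmx J i k *: y k))@_U_(j) = (invmx J *m J) i j.
      rewrite mxE; apply: eq_bigr => l _.
      by rewrite [X in X@__]lrmorphZ mcoeffZ !mxE.
    by rewrite mulVmx // mxE subrr.
  rewrite mdeg_eq0 => /eqP ->; rewrite mcoeffB mcoeffX mnm1_eq0 subr0.
  rewrite rmorph_sum raddf_sum big1 //= => l _.
  by rewrite [X in X@__]lrmorphZ mcoeffZ y0 mulr0.
elim: k => [|k [Q HQ]]; first by exists 0.
move: HQ; move Eg: (P - subst y Q) => g Hg.
exists (Q + subst (fun j => \sum_i invmx J j i *: 'X_i) (tau g)).
rewrite (lrmorphD (subst y)) opprD addrA Eg.
have -> : subst y (subst (fun j => \sum_i invmx J j i *: 'X_i) (tau g)) =
    subst y' (tau g).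
  apply: (@lrmorph_eqX _ _ (subst y \o subst _) (subst y')) => i.
  rewrite substX /= substX rmorph_sum; apply: eq_bigr => l _.
  by rewrite [LHS]lrmorphZ substX.
rewrite lrmorphB.
have -> : tau (subst y' (tau g)) = subst (tau \o y') (tau g).
  apply: (@lrmorph_eqX _ _ (aut_fun tau \o subst y') (subst _)) => i.
  by rewrite substX /= substX.
rewrite -opprB -scaleN1r; apply: ordgeZ.
exact: (ordge_subst Hy' Hg).1.
Qed.

Definition wtm (m : 'X_{1..n}) : W := \sum_i w i *+ m i.

(** Approximate [f] at [a] by a polynomial in the [y i], to an order that [f] itself does not reach,
    and take the parts of weight [v]. The error is then a multiple of [f] by [wt_line], and its
    order forces it to be zero. *)
Lemma wt_subst_generates v f : wt v f -> f != 0 ->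
  (exists m, wtm m = v) /\ exists Q, f = subst y Q.
Proof.
move=> vf f0.
have [k Hk] : exists k, ~ ordge k (tau f).
  by apply: ordge_neq0; apply: contraNneq f0 => E; apply/eqP/(@aut_inj _ _ tau);
    rewrite E rmorph0.
have [Q0 /(graded_pow grW Ha) [s Hs Es]] := approx_subst k f.
pose s1 := [seq (wtm m, Q0@_m *: \prod_i y i ^+ m i) | m <- msupp Q0].
have Ef : f = sum_wt (s1 ++ s).
  rewrite /sum_wt big_cat /= -/(sum_wt s) -Es big_map /=.
  by rewrite -[X in X + _](substE y Q0) addrC subrK.
have wts1 x : x \in s1 ++ s -> wt x.1 x.2.
  rewrite mem_cat => /orP[/mapP [m _ ->]|/Hs []//] /=.
  by apply: (wt_scale grW); apply: (wt_prod grW).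
move: (wt_component grW vf wts1 Ef); rewrite big_cat /= big_map /=.
set A := \sum_(_ <- _ | _) _; set B := \sum_(_ <- _ | _) _ => EAB.
have wB : wt v B.
  rewrite /B big_seq_cond; apply: (wt_sum grW) => x /andP[/Hs [wx _] /eqP <-].
  exact: wx.
have oB : ordge k (tau B).
  rewrite /B rmorph_sum big_seq_cond; apply: ordge_sum => x /andP[/Hs [_ ox] _].
  exact: ox.
have B0 : B = 0.
  have [c Ec] := wt_line grW wB vf f0.
  have [c0|c0] := eqVneq c 0; first by rewrite Ec c0 scale0r.
  case: Hk; have -> : f = c^-1 *: B by rewrite Ec scalerA mulVf // scale1r.
  by rewrite lrmorphZ; apply: ordgeZ.
rewrite B0 addr0 in EAB; split.
  apply: NNPP => H; move: f0; rewrite EAB /A big1 ?eqxx // => m /eqP E.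
  by case: H; exists m.
exists (\sum_(m <- msupp Q0 | wtm m == v) Q0@_m *: 'X_[m]).
rewrite [LHS]EAB rmorph_sum; apply: eq_bigr => m _.
rewrite [RHS]lrmorphZ mpolyXE_id rmorph_prod; congr (_ *: _).
by apply: eq_bigr => i _; rewrite rmorphXn /= substX.
Qed.

Definition wt_mx : 'M[rat]_n := \matrix_(i, j) (w i 0 j)%:~R.

(** Every weight of a nonzero vector is a combination of the [w i], so these have rank [n] by
    [wt_full]. *)
Lemma wt_mx_unit : wt_mx \in unitmx.
Proof.
rewrite -unitmx_tr -row_free_unit; apply: inj_row_free => v vM.
have [D [D0 [u Eu]]] := clear_denominators v.
suff u0 : u = 0.
  apply/eqP; have /esym/eqP := Eu; rewrite u0 map_mx0 scaler_eq0 intr_eq0.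
  by rewrite (negPf D0).
have Hi i : \sum_j w i 0 j * u 0 j = 0.
  apply/eqP; rewrite -(intr_eq0 rat) rmorph_sum /=.
  have /rowP/(_ i) : map_mx intr u *m wt_mx^T = 0 by rewrite Eu -scalemxAl vM scaler0.
  rewrite !mxE => E; apply/eqP; rewrite -[RHS]E; apply: eq_bigr => j _.
  by rewrite !mxE intrM mulrC.
apply: (wt_full grW) => v' f vf f0.
have [[m <-] _] := wt_subst_generates vf f0.
rewrite (eq_bigr (fun j => \sum_i (w i 0 j * u 0 j) *+ m i)) => [|j _].
  rewrite exchange_big /= big1 // => i _.
  by rewrite sumrMnl Hi mul0rn.
rewrite /wtm summxE mulr_suml; apply: eq_bigr => i _.
by rewrite mulmxnE mulrnAl.
Qed.

Lemma wtm_inj : injective wtm.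
Proof.
move=> m m' E; apply/mnmP => i.
have : (\row_i ((m i)%:R - (m' i)%:R)) *m wt_mx = 0 :> 'rV[rat]_n.
  apply/rowP => j; rewrite mxE.
  have /(congr1 (intr : int -> rat)) := congr1 (fun x : W => x 0 j) E.
  rewrite /wtm !summxE !rmorph_sum /= => /eqP; rewrite -subr_eq0 -sumrB => /eqP E'.
  rewrite [RHS]mxE -[RHS]E'; apply: eq_bigr => l _.
  by rewrite !mxE mulrBl !mulmxnE; congr (_ - _); rewrite mulr_natl [RHS]rmorphMn.
move/eqP; rewrite mulmx_free_eq0 ?row_free_unit ?wt_mx_unit // => /eqP /rowP /(_ i).
by rewrite !mxE => /eqP; rewrite subr_eq0 eqr_nat => /eqP.
Qed.

(** Distinct monomials in the [y i] are nonzero vectors of distinct weights, hence independent. *)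
Lemma subst_y_inj Q : subst y Q = 0 -> Q = 0.
Proof.
move=> Q0.
have yN0 i : y i != 0.
  apply: contraTneq Junit => Ei; rewrite -row_free_unit; apply/negP => Jfree.
  have /eqP : delta_mx 0 i *m J = 0 :> 'rV_n.
    by rewrite -rowE; apply/rowP => j; rewrite !mxE Ei rmorph0 mcoeff0.
  rewrite mulmx_free_eq0 // => /eqP /rowP /(_ i); rewrite !mxE !eqxx => /eqP.
  by rewrite oner_eq0.
have E : \sum_(m : 'X_{1..n < msize Q}) Q@_m *: \prod_i y i ^+ m i = 0.
  rewrite -[RHS]Q0 [X in subst y X](mpolywE (leqnn (msize Q))) rmorph_sum; apply: eq_bigr => m _.
  rewrite [RHS]lrmorphZ mpolyXE_id rmorph_prod; congr (_ *: _).
  by apply: eq_bigr => i _; rewrite rmorphXn /= substX.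
apply/mpolyP => m; rewrite mcoeff0; have [mB|mB] := ltnP (mdeg m) (msize Q); last first.
  by apply/memN_msupp_eq0/msize_mdeg_ge.
have /eqP := wt_inj_eq0 grW (w := fun m : 'X_{1..n < msize Q} => wtm m)
  (inj_comp wtm_inj val_inj)
  (fun m => wt_scale grW _ (wt_prod grW _ _ wy)) E (BMultinom mB).
rewrite scaler_eq0 => /orP[/eqP //|]; rewrite prodf_seq_eq0.
by case/hasP=> i _ /=; rewrite expf_eq0 (negPf (yN0 i)) andbF.
Qed.

Lemma subst_y_surj P : exists Q, subst y Q = P.
Proof.
have [s Hs ->] := span_wt grW P; elim: s Hs => [|x s IH] Hs.
  by exists 0; rewrite rmorph0 /sum_wt big_nil.
have [|Q1 E1] := IH; first by move=> x' xs; apply: Hs; rewrite inE xs orbT.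
rewrite /sum_wt big_cons -/(sum_wt s).
have [->|x0] := eqVneq x.2 0; first by exists Q1; rewrite add0r.
have [_ [Q2 ->]] := wt_subst_generates (Hs x (mem_head _ _)) x0.
by exists (Q2 + Q1); rewrite lrmorphD E1.
Qed.

Lemma wt_coordinates_aut : exists beta : polyAut K n, forall i, beta 'X_i = y i.
Proof.
have /fin_all_exists [z Hz] : forall i, exists Q, subst y Q = 'X_i.
  by move=> i; apply: subst_y_surj.
have Hyz i : subst z (y i) = 'X_i.
  apply/eqP; rewrite -subr_eq0; apply/eqP/subst_y_inj.
  by rewrite lrmorphB (subst_cancel Hz) substX subrr.
by exists (subst_aut Hyz Hz) => i; apply: substX.
Qed.
End Coordinates.

(** The Bialynicki-Birula theorem: the torus action is diagonal in the polynomial coordinates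
    [beta 'X_i]. *)
Lemma linearize : exists beta : polyAut K n, exists w : 'I_n -> W,
  (forall i, wt (w i) (beta 'X_i)) /\ wt_mx w \in unitmx.
Proof.
have /fin_all_exists [a Ha] := fun i => maxid_codim1 grW ('X_i).
have [y [w [Hy Junit]]] := exists_wt_coordinates grW Ha.
have wy i := (Hy i).1; have y0 i := (Hy i).2.
have [beta Hb] := wt_coordinates_aut Ha wy y0 Junit.
exists beta, w; split=> [i|]; first by rewrite Hb.
exact: wt_mx_unit Ha wy y0 Junit.
Qed.
End LinearizationTheorem.


(** * Nice automorphisms, the extension of [Phi], and diagonal one-parameter subgroups *)

Section NiceAutomorphisms.
Variables (K : closedFieldType) (n : nat).
Local Notation R := {mpoly K[n]}.
Local Notation "f ** g" := (aut_mul f g) (at level 40, left associativity).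
Local Notation one := (aut_one K n).
Implicit Types (f g h : polyAut K n) (p : R).

Lemma naut_ext (f g : NAut K n) : nval f = nval g -> f = g.
Proof.
case: f g => f Hf [g Hg] /= E; case: _ / E in Hg *.
by rewrite (proof_irrelevance _ Hf Hg).
Qed.

Lemma in_max_pow0 m : in_max_pow m (0 : R).
Proof.
elim: m => // m IH; exists (fun=> 0); split=> //.
by rewrite big1 // => i _; rewrite mul0r.
Qed.

Lemma in_max_powZ m c p : in_max_pow m p -> in_max_pow m (c *: p).
Proof.
elim: m p => // m IH p [q [Hq ->]]; exists (fun i => c *: q i); split.
  by move=> i; apply: IH (Hq i).
by rewrite scaler_sumr; apply: eq_bigr => i _; rewrite scalerAl.
Qed.

Lemma in_max_pow_ord m p : in_max_pow m p -> ordge m p.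
Proof.
elim: m p => // m IH p [q [Hq ->]]; apply: ordge_sum => i _.
rewrite -addn1; apply: ordgeM; first exact: IH (Hq i).
move=> k; rewrite ltnS leqn0 mdeg_eq0 => /eqP ->.
by rewrite mcoeffX mnm1_eq0.
Qed.

Lemma in_max_pow_diag m s p : in_max_pow m p -> in_max_pow m (diag s p).
Proof.
elim: m p => // m IH p [q [Hq ->]].
exists (fun i => unz (s i) *: diag s (q i)); split.
  by move=> i; apply/in_max_powZ/IH/Hq.
rewrite rmorph_sum; apply: eq_bigr => i _.
by rewrite [LHS]lrmorphM diagX -scalerAr scalerAl.
Qed.

Lemma nice_tame f : tame f -> nice f.
Proof.
move=> tf m; exists one, f; split=> // [|i]; first by rewrite aut_1mul.
by rewrite subrr; apply: in_max_pow0.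
Qed.

Lemma nice_mul_tame f g : nice f -> tame g -> nice (f ** g).
Proof.
move=> nf tg m; have [psi [phi [tphi -> Hpsi]]] := nf m.
exists psi, (phi ** g); split=> //; first exact: tame_mul.
by rewrite aut_mulA.
Qed.

(** The diagonal factor is moved past [psi] by conjugation, which only rescales variables and so
    preserves congruence to the identity modulo powers of the ideal. *)
Lemma nice_diag_mul s f : nice f -> nice (diag s ** f).
Proof.
move=> nf m; have [psi [phi [tphi -> Hpsi]]] := nf m.
exists (diag s ** psi ** aut_inv (diag s)), (diag s ** phi); split.
- by apply: tame_mul => //; apply: tame_diag.
- by rewrite !aut_mulA aut_mulVK.
move=> i; have -> : (diag s ** psi ** aut_inv (diag s)) 'X_i - 'X_i =
    (unz (s i))^-1 *: diag s (psi 'X_i - 'X_i).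
  rewrite !aut_mulE diag_invX !autZ lrmorphB diagX scalerBr scalerA.
  by rewrite mulVf ?unz_neq0 // scale1r.
by apply: in_max_powZ; apply: in_max_pow_diag.
Qed.

Lemma nice_one : nice one. Proof. by apply: nice_tame; apply: tame_one. Qed.

(* [Phi], extended by the identity automorphism outside of [NAut] *)
Definition extend (Phi : NAut K n -> NAut K n) f : polyAut K n :=
  match excluded_middle_informative (nice f) with
  | left nf => Phi (MkNAut nf)
  | right _ => one
  end.

Lemma extendE Phi (f : NAut K n) : extend Phi f = Phi f.
Proof.
rewrite /extend; case: excluded_middle_informative => [nf|]; last first.
  by case; apply: nvalP.
by congr (nval (Phi _)); apply: naut_ext.
Qed.

Lemma extend_mul Phi f g : naut_multiplicative Phi ->
    nice f -> nice g -> nice (f ** g) ->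
  extend Phi (f ** g) = extend Phi f ** extend Phi g.
Proof.
move=> PhiM nf ng nfg.
have := PhiM (MkNAut nf) (MkNAut ng) (MkNAut nfg) erefl.
by rewrite -!extendE.
Qed.

Lemma extend_one Phi : naut_multiplicative Phi -> extend Phi one = one.
Proof.
move=> PhiM; apply: (@aut_mulI _ _ (extend Phi one)).
have n11 : nice (one ** one) by rewrite aut_mul1; apply: nice_one.
rewrite -(extend_mul PhiM nice_one nice_one n11) !aut_mul1 //.
Qed.

Lemma extend_inv Phi f : naut_multiplicative Phi -> tame f ->
  extend Phi (aut_inv f) = aut_inv (extend Phi f).
Proof.
move=> PhiM tf; apply/esym/aut_inv_eq; rewrite -(extend_one PhiM) -(aut_mulV f).
apply/esym/extend_mul => //; apply: nice_tame => //.
  exact: tame_inv.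
by rewrite aut_mulV; apply: tame_one.
Qed.

Lemma extend_inj Phi f g : injective Phi -> nice f -> nice g ->
  extend Phi f = extend Phi g -> f = g.
Proof.
move=> inj nf ng; rewrite -[f]/(nval (MkNAut nf)) -[g]/(nval (MkNAut ng)).
by rewrite !extendE => /naut_ext /inj ->.
Qed.

Lemma extend_fam Phi S A (rrA : regular_ring S A) (g : K -> polyAut K n) :
    ind_morphism Phi -> (forall t, nice (g t)) ->
    (forall i, fam S A (fun t => g t 'X_i)) ->
    (forall i, fam S A (fun t => aut_inv (g t) 'X_i)) ->
  forall i, fam S A (fun t => extend Phi (g t) 'X_i).
Proof.
move=> indPhi ng Hg Hg' i.
apply: (fam_ext rrA) (ind_morphism_fam rrA indPhi (g := fun t => MkNAut (ng t)) Hg Hg' i).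
by move=> t _; rewrite -extendE.
Qed.

Definition delta (j : 'I_n) (t : K) := diag (fun i => if i == j then t else 1).

Lemma deltaX j t i : t != 0 ->
  delta j t 'X_i = (if i == j then t else 1) *: 'X_i.
Proof. by move=> t0; rewrite diagX unzE //; case: ifP; rewrite ?oner_neq0. Qed.

Lemma delta_invX j t i : t != 0 ->
  aut_inv (delta j t) 'X_i = (if i == j then t^-1 else 1) *: 'X_i.
Proof.
move=> t0; rewrite diag_invX unzE; last by case: ifP; rewrite ?oner_neq0.
by case: ifP; rewrite ?invr1.
Qed.

Lemma diagM (s s' : 'I_n -> K) : (forall i, s i != 0) -> (forall i, s' i != 0) ->
  diag s ** diag s' = diag (fun i => s i * s' i).
Proof.
move=> s0 s'0; apply: aut_eqX => i.
by rewrite aut_mulE !diagX !unzE ?mulf_neq0 // autZ diagX unzE // scalerA mulrC.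
Qed.

Lemma diag_eq (s s' : 'I_n -> K) : s =1 s' -> diag s = diag s'.
Proof. by move=> E; apply: aut_eqX => i; rewrite !diagX E. Qed.

Lemma diag1 (s : 'I_n -> K) : (forall i, s i = 1) -> diag s = one.
Proof.
by move=> E; apply: aut_eqX => i; rewrite diagX E unzE ?oner_neq0 // scale1r.
Qed.

Lemma diagC (s s' : 'I_n -> K) : diag s ** diag s' = diag s' ** diag s.
Proof.
apply: aut_eqX => i; rewrite !aut_mulE !diagX !autZ !diagX !scalerA.
by rewrite mulrC.
Qed.

Lemma deltaM j t t' : t != 0 -> t' != 0 -> delta j t ** delta j t' = delta j (t * t').
Proof.
move=> t0 t'0; rewrite diagM; try by move=> i; case: ifP; rewrite ?oner_neq0.
by apply: diag_eq => i; case: ifP; rewrite ?mulr1.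
Qed.

Lemma diag_ind (G : polyAut K n -> Prop) : G one ->
    (forall f j t, t != 0 -> G f -> tame f -> G (delta j t ** f)) ->
  forall s : 'I_n -> K, (forall i, s i != 0) -> G (diag s).
Proof.
move=> G1 GM s s0.
pose sr (r : seq 'I_n) i := if i \in r then s i else 1.
have sr0 r i : sr r i != 0 by rewrite /sr; case: ifP; rewrite ?oner_neq0.
suff H r : uniq r -> G (diag (sr r)).
  have := H _ (enum_uniq 'I_n); congr (G _); apply: diag_eq => i.
  by rewrite /sr mem_enum.
elim: r => [_|j r IH /= /andP[jr ur]]; first by rewrite diag1.
have -> : diag (sr (j :: r)) = delta j (s j) ** diag (sr r).
  rewrite diagM //; last by move=> i; case: ifP; rewrite ?oner_neq0.
  apply: diag_eq => i; rewrite /sr inE; case: eqP => [->|_] /=.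
    by rewrite (negPf jr) mulr1.
  by rewrite mul1r.
by apply: GM => //; [apply: IH | apply: tame_diag].
Qed.

Lemma laurent_id : laurent (fun t : K => t).
Proof. by exists 'X, 0%N => t _; rewrite hornerX expr0 divr1. Qed.

Lemma laurent_inv : laurent (fun t : K => t^-1).
Proof. by exists 1, 1%N => t _; rewrite hornerC expr1 mul1r. Qed.

Lemma fam_delta j i : fam (fun t => t != 0) (@laurent K) (fun t => delta j t 'X_i).
Proof.
have rr := laurent_ring K.
apply: (fam_ext rr (F := fun t => (if i == j then t else 1) *: 'X_i)).
  by move=> t t0; rewrite deltaX.
apply: (famZ rr (a := fun t => if i == j then t else 1)).
by case: (i == j); [apply: laurent_id | apply: (rr_cst rr)].
Qed.

Lemma fam_delta_inv j i :
  fam (fun t => t != 0) (@laurent K) (fun t => aut_inv (delta j t) 'X_i).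
Proof.
have rr := laurent_ring K.
apply: (fam_ext rr (F := fun t => (if i == j then t^-1 else 1) *: 'X_i)).
  by move=> t t0; rewrite delta_invX.
apply: (famZ rr (a := fun t => if i == j then t^-1 else 1)).
by case: (i == j); [apply: laurent_inv | apply: (rr_cst rr)].
Qed.

Lemma curve_eq0 E (U : 'I_E -> R) :
  (forall t : K, t != 0 -> \sum_(e < E) t ^+ e *: U e = 0) -> forall e, U e = 0.
Proof.
move=> H e; apply/mpolyP => m; rewrite mcoeff0.
pose P := \poly_(i < E) (if insub i is Some e then (U e)@_m else 0).
have P0 : P = 0.
  apply: poly_eq0_horner_nz => t t0; rewrite horner_poly.
  have /(congr1 (mcoeff m)) := H t t0; rewrite raddf_sum mcoeff0 /= => E0.
  rewrite -[RHS]E0; apply: eq_bigr => i _.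
  by rewrite mcoeffZ valK mulrC.
by have := congr1 (fun q : {poly K} => q`_e) P0; rewrite coef_poly ltn_ord valK coef0.
Qed.

Lemma exprz_neq (z z' : int) : z != z' -> exists2 t : K, t != 0 & t ^ z != t ^ z'.
Proof.
move=> zz'; have [t t0 tk] : exists2 t : K, t != 0 & t ^ (z - z') != 1.
  have : z - z' != 0 by rewrite subr_eq0.
  case: (z - z') => k k0.
    by have [|t t0 tk] := @expf_neq1 K k; [rewrite lt0n; apply: contraNneq k0 => -> | exists t].
  have [|t t0 tk] := @expf_neq1 K k.+1; first by [].
  by exists t => //; change ((t ^+ k.+1)^-1 != 1); rewrite invr_eq1.
exists t => //; apply: contraNneq tk => E.
by rewrite expfzDr // E -expfzDr // subrr.
Qed.
End NiceAutomorphisms.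

(** * The grading defined by the image of the diagonal torus *)

Section TorusGrading.
Variables (K : closedFieldType) (n : nat).
Local Notation R := {mpoly K[n]}.
Local Notation W := 'rV[int]_n.
Local Notation "f ** g" := (aut_mul f g) (at level 40, left associativity).
Local Notation one := (aut_one K n).
Implicit Types (f g h : polyAut K n) (p : R) (w : W).
Variable Phi : NAut K n -> NAut K n.
Hypothesis PhiM : naut_multiplicative Phi.
Hypothesis Phi_ind : ind_morphism Phi.
Hypothesis Phi_inj : injective Phi.
Local Notation Ph := (extend Phi).

Definition rho j t := Ph (delta j t).

Lemma Ph_tameM f g : tame f -> tame g -> Ph (f ** g) = Ph f ** Ph g.
Proof.
move=> tf tg; apply: extend_mul => //; apply: nice_tame => //.
exact: tame_mul.
Qed.

Lemma rhoM j t t' : t != 0 -> t' != 0 -> rho j t ** rho j t' = rho j (t * t').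
Proof.
by move=> t0 t'0; rewrite /rho -Ph_tameM ?deltaM //; apply: tame_diag.
Qed.

Lemma rho1 j : rho j 1 = one.
Proof. by rewrite /rho /delta diag1 ?extend_one // => i; case: ifP. Qed.

Lemma rhoC j t j' t' : rho j t ** rho j' t' = rho j' t' ** rho j t.
Proof.
by rewrite /rho -!Ph_tameM /delta 1?diagC //; apply: tame_diag.
Qed.

Lemma rho_fam j p : fam (fun t => t != 0) (@laurent K) (fun t => rho j t p).
Proof.
have rr := laurent_ring K.
apply: (fam_app rr (f := rho j)) => [i|]; last exact: fam_cst.
apply: (extend_fam rr) => // [t|i'|i']; first by apply: nice_tame; apply: tame_diag.
  exact: fam_delta.
exact: fam_delta_inv.
Qed.

(* A one-parameter subgroup acts through finitely many powers of [t]. *)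
Lemma rho_decomposition j p : exists E (G : 'I_E -> R) (z : 'I_E -> int),
  [/\ p = \sum_e G e,
      forall e t, t != 0 -> rho j t (G e) = t ^ z e *: G e &
      forall l s c, rho l s p = c *: p -> forall e, rho l s (G e) = c *: G e].
Proof.
have [[B HB] Hco] := rho_fam j p.
have /fin_all_exists [q /fin_all_exists [k Hqk]] :
    forall m : 'X_{1..n < B}, exists q k, forall t, t != 0 ->
      (rho j t p)@_m = q.[t] / t ^+ k by move=> m; apply: Hco.
(* A common denominator: [t^k0] times [rho j t p] is a polynomial curve in [t], with coefficients
   [G e]. *)
pose k0 := (\sum_m k m)%N.
pose q' m := q m * 'X^(k0 - k m).
have Hq' m t : t != 0 -> t ^+ k0 * (rho j t p)@_(m : 'X_{1..n < B}) = (q' m).[t].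
  move=> t0; rewrite Hqk // /q' hornerM hornerXn.
  have -> : t ^+ k0 = t ^+ (k0 - k m) * t ^+ k m.
    by rewrite -exprD subnK // /k0 (bigD1 m) //= leq_addr.
  by rewrite mulrCA mulfK ?expf_neq0.
pose E := \max_m size (q' m).
pose G (e : 'I_E) : R := \sum_(m : 'X_{1..n < B}) (q' m)`_e *: 'X_[m].
have HG (t : K) : t != 0 -> t ^+ k0 *: rho j t p = \sum_(e < E) t ^+ e *: G e.
  move=> t0; rewrite [in LHS](mpolywE (HB t t0)) scaler_sumr.
  under [RHS]eq_bigr => e _ do rewrite scaler_sumr.
  rewrite exchange_big /=; apply: eq_bigr => m _.
  rewrite scalerA Hq' // (@horner_coef_wide _ E); last exact: leq_bigmax.
  by rewrite scaler_suml; apply: eq_bigr => e _; rewrite scalerA mulrC.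
have comm l s c : rho l s p = c *: p -> forall e, rho l s (G e) = c *: G e.
  move=> Ep e; apply/eqP; rewrite -subr_eq0; apply/eqP; move: e.
  apply: (@curve_eq0 _ _ _ (fun e : 'I_E => rho l s (G e) - c *: G e)) => t t0.
  rewrite (eq_bigr (fun e : 'I_E => rho l s (t ^+ e *: G e) - c *: (t ^+ e *: G e))).
    rewrite sumrB -scaler_sumr -rmorph_sum /= -HG // autZ.
    by rewrite -[rho l s (rho j t p)]/((rho l s ** rho j t) p) rhoC aut_mulE Ep
      autZ !scalerA mulrC subrr.
  by move=> e _; rewrite autZ scalerBr !scalerA mulrC.
exists E, G, (fun e : 'I_E => e%:Z - k0%:Z); split=> //.
  have := HG 1 (oner_neq0 _); rewrite rho1 expr1n scale1r => E1.
  rewrite -[LHS]/(one p) [LHS]E1.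
  by apply: eq_bigr => e _; rewrite expr1n scale1r.
(* Compare the coefficients of [t^e] in [rho(s) (rho(t) p) = rho(s t) p]. *)
move=> e s s0; apply/eqP; rewrite -subr_eq0; apply/eqP; move: e.
apply: (@curve_eq0 _ _ _ (fun e : 'I_E => rho j s (G e) - s ^ (e%:Z - k0%:Z) *: G e)) => t t0.
rewrite (eq_bigr (fun e : 'I_E => rho j s (t ^+ e *: G e) - (s ^+ k0)^-1 *: ((s * t) ^+ e *: G e))).
  rewrite sumrB -scaler_sumr -rmorph_sum /= -!HG ?mulf_neq0 // autZ.
  rewrite -[rho j s (rho j t p)]/((rho j s ** rho j t) p) rhoM // scalerA.
  by rewrite exprMn mulrA mulVf ?expf_neq0 // mul1r subrr.
move=> e _; rewrite autZ scalerBr !scalerA; congr (_ - _ *: _).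
by rewrite expfzDr // -invr_expz -!exprnP exprMn; ring.
Qed.

Definition torus_wt w p := forall j t, t != 0 -> rho j t p = t ^ (w 0 j) *: p.

(** The [n] commuting one-parameter subgroups are diagonalized in turn; the components found for one
    of them keep their eigenvalues for the previous ones. *)
Lemma torus_dec p : span (is_wt torus_wt) p.
Proof.
suff H (r : seq 'I_n) : span (fun x => forall j t, j \in r -> t != 0 ->
    rho j t x.2 = t ^ (x.1 0 j) *: x.2) p.
  apply: span_sub (H (enum 'I_n)) => x Hx j t t0.
  by apply: Hx; rewrite ?mem_enum.
elim: r => [|j r [s Hs ->]].
  by apply: (span1 (x := (0, p))).
rewrite /sum_wt big_seq; apply: span_sum => x /Hs Hx.
have [E [G [z [Ex Hz comm]]]] := rho_decomposition j x.2; rewrite Ex.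
apply: span_sum => e _.
apply: (span1 (x := (\row_l (if l == j then z e else x.1 0 l), G e))) => l t /=.
rewrite inE mxE => /orP[/eqP ->|lr] t0; first by rewrite eqxx Hz.
case: eqP => [->|_]; first exact: Hz.
by apply: comm; apply: Hx.
Qed.

(** Independence of characters: for suitable [j] and [t], the operator [rho j t - t ^ (x.1 0 j)]
    kills the summand [x] and multiplies [p] by a nonzero scalar. *)
Lemma torus_indep w p (s : seq (W * R)) : torus_wt w p ->
  (forall x, x \in s -> x.1 != w /\ torus_wt x.1 x.2) -> p = sum_wt s -> p = 0.
Proof.
move Es: (size s) => N; elim: N s Es p => [|N IH] [|x s] //= Es p wp Hs.
  by rewrite /sum_wt big_nil.
case: Es => Es; rewrite /sum_wt big_cons -/(sum_wt s) => Ep.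
have [xw wx] := Hs x (mem_head _ _).
have [j jxw] : exists j, x.1 0 j != w 0 j.
  apply/existsP; apply: contraNT xw; rewrite negb_exists => /forallP H.
  by apply/eqP/rowP => j; have := H j; rewrite negbK => /eqP.
have [t t0 txw] := @exprz_neq K _ _ jxw.
pose c (v : W) := t ^ (v 0 j) - t ^ (x.1 0 j).
have cw : c w != 0 by rewrite subr_eq0 eq_sym.
apply/eqP; suff : c w *: p == 0 by rewrite scaler_eq0 (negPf cw).
have wtZ v a q : torus_wt v q -> torus_wt v (a *: q).
  by move=> wq l u u0; rewrite autZ wq // !scalerA mulrC.
pose s' := [seq (y.1, c y.1 *: y.2) | y <- s].
apply/eqP/(IH s' _ _ (wtZ _ _ _ wp)); first by rewrite size_map.
  move=> _ /mapP [y ys ->] /=; have [|yw wy] := Hs y; first by rewrite inE ys orbT.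
  by split=> //; apply: wtZ.
rewrite /sum_wt big_map /= /c.
rewrite scalerBl -(wp j t t0) [in X in X - _ = _]Ep lrmorphD (wx j t t0).
rewrite [X in _ - _ *: X = _]Ep scalerDr opprD addrACA subrr add0r.
rewrite /sum_wt rmorph_sum scaler_sumr -sumrB big_seq [RHS]big_seq.
apply: eq_bigr => y ys; have [|_ wy] := Hs y; first by rewrite inE ys orbT.
by rewrite scalerBl -(wy j t t0).
Qed.

Lemma Ph_diag_wt w p (s : 'I_n -> K) : torus_wt w p -> (forall i, s i != 0) ->
  Ph (diag s) p = \prod_j s j ^ (w 0 j) *: p.
Proof.
move=> wp s0; pose sr (r : seq 'I_n) i := if i \in r then s i else 1.
have sr0 r i : sr r i != 0 by rewrite /sr; case: ifP; rewrite ?oner_neq0.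
suff H r : uniq r -> Ph (diag (sr r)) p = \prod_(j <- r) s j ^ (w 0 j) *: p.
  have := H _ (enum_uniq 'I_n); rewrite big_enum /= => <-.
  by congr (Ph _ p); apply: diag_eq => i; rewrite /sr mem_enum.
elim: r => [_|j r IH /= /andP[jr ur]].
  by rewrite diag1 // extend_one // big_nil scale1r.
have -> : diag (sr (j :: r)) = delta j (s j) ** diag (sr r).
  rewrite diagM //; last by move=> i; case: ifP; rewrite ?oner_neq0.
  apply: diag_eq => i; rewrite /sr inE; case: eqP => [->|_] /=.
    by rewrite (negPf jr) mulr1.
  by rewrite mul1r.
rewrite Ph_tameM; try exact: tame_diag.
rewrite aut_mulE IH // autZ -[Ph _]/(rho j (s j)) wp // scalerA big_cons.
by rewrite mulrC.
Qed.

(** For [wt_full]: if [v] is orthogonal to all weights, the one-parameter subgroup [diag (t^v)] has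
    trivial image under [Phi], so it is trivial and [v = 0]. *)
Lemma torus_full_grading : full_grading torus_wt.
Proof.
split.
- by move=> w j t _; rewrite rmorph0 scaler0.
- by move=> w p q wp wq j t t0; rewrite lrmorphD wp // wq // scalerDr.
- by move=> w c p wp j t t0; rewrite autZ wp // !scalerA mulrC.
- by move=> j t _; rewrite rmorph1 mxE expr0z scale1r.
- move=> w w' p q wp wq j t t0; rewrite lrmorphM wp // wq // mxE expfzDr //.
  by rewrite -scalerAl -scalerAr scalerA.
- exact: torus_indep.
- by move=> p; have [s] := torus_dec p; exists s.
move=> v Hv.
have Hid t : t != 0 -> diag (fun j => t ^ (v 0 j)) = one.
  move=> t0; have s0 (i : 'I_n) : t ^ (v 0 i) != 0 by rewrite expfz_neq0.
  apply: (extend_inj Phi_inj); [by apply/nice_tame/tame_diag | exact: nice_one |].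
  rewrite extend_one //; apply: polyAut_ext => p.
  have [s Hs ->] := torus_dec p; rewrite /sum_wt !rmorph_sum.
  apply: eq_big_seq => x xs; have wx : torus_wt x.1 x.2 := Hs x xs.
  rewrite [LHS](Ph_diag_wt wx s0) [RHS]/=.
  have [->|x0] := eqVneq x.2 0; first by rewrite scaler0.
  rewrite (_ : \prod_j _ = t ^ (\sum_j x.1 0 j * v 0 j)).
    by rewrite (Hv _ _ wx x0) expr0z scale1r.
  elim: (index_enum _) => [|j r IH]; first by rewrite !big_nil expr0z.
  by rewrite !big_cons expfzDr // IH exprz_exp [v 0 j * _]mulrC.
apply/rowP => j; rewrite mxE; apply/eqP/negPn/negP => vj.
have [t t0] := @exprz_neq K _ _ vj; rewrite expr0z => /eqP; apply.
have E : (diag (fun j => t ^ (v 0 j)) 'X_j)@_U_(j) = ('X_j : R)@_U_(j).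
  by rewrite Hid.
by move: E; rewrite diagX unzE ?expfz_neq0 // mcoeffZ mcoeffXU eqxx mulr1.
Qed.
End TorusGrading.

(** * Root subgroups of the diagonal torus and their images *)

Section RootSubgroups.
Variables (K : closedFieldType) (n : nat).
Local Notation R := {mpoly K[n]}.
Local Notation W := 'rV[int]_n.
Local Notation "f ** g" := (aut_mul f g) (at level 40, left associativity).
Local Notation one := (aut_one K n).
Implicit Types (f g h : polyAut K n) (p : R) (i j k l : 'I_n) (m M : 'X_{1..n}).

Definition root_elem i (m : 'X_{1..n}) (c : K) := elem i (c *: 'X_[m] : R).
Local Notation U := root_elem.

(** The character through which the torus normalizes the root subgroup [U i m]. Its entries are
    rational because weight matrices get inverted. *)
Definition root_wt (i : 'I_n) (m : 'X_{1..n}) : 'rV[rat]_n :=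
  \row_l ((m l)%:R - (l == i)%:R).

Lemma tame_root i m c : tame (U i m c). Proof. exact: tame_elem. Qed.

Lemma root_elemX i m c j : m i = 0%N ->
  U i m c 'X_j = if j == i then 'X_i + c *: 'X_[m] else 'X_j.
Proof. by move=> mi; rewrite elemX lrmorphZ killX. Qed.

Lemma root_elemD i m c c' : U i m (c + c') = U i m c ** U i m c'.
Proof. by rewrite /U scalerDl elemD. Qed.

Lemma root_elem0 i m : U i m 0 = one.
Proof. by rewrite /U scale0r elem0. Qed.

Lemma root_elem_inv i m c : aut_inv (U i m c) = U i m (- c).
Proof. by apply: aut_inv_eq; rewrite -root_elemD subrr root_elem0. Qed.

Lemma mnm_neqU (m : 'X_{1..n}) i : m i = 0%N -> (U_(i)%MM == m) = false.
Proof. by move=> mi; apply/eqP => E; move: mi; rewrite -E mnm1E eqxx. Qed.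

Lemma root_elem_coef i m c : m i = 0%N -> (U i m c 'X_i)@_m = c.
Proof.
move=> mi; rewrite root_elemX // eqxx mcoeffD mcoeffX mnm_neqU // add0r.
by rewrite mcoeffZ mcoeffX eqxx mulr1.
Qed.

Lemma fam_root i m j :
  fam (fun=> True) (@poly_gap K 0) (fun c => U i m c 'X_j).
Proof.
have rr := poly_gap_ring K 0.
apply: (fam_ext rr (F := fun c => (if j == i then 'X_i else 'X_j) +
   (if j == i then c else 0) *: kill K i 'X_[m])).
  by move=> c _; rewrite elemX lrmorphZ; case: eqP => // _; rewrite scale0r addr0.
apply: (famD rr); first exact: fam_cst.
apply: (famZ rr (a := fun c => if j == i then c else 0)); case: (j == i).
  by exists 0, 'X => t; rewrite hornerX expr0 mul1r add0r.
exact: rr_cst rr _.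
Qed.

Lemma fam_root_inv i m j :
  fam (fun=> True) (@poly_gap K 0) (fun c => aut_inv (U i m c) 'X_j).
Proof.
have rr := poly_gap_ring K 0.
apply: (fam_ext rr (F := fun c => (if j == i then 'X_i else 'X_j) +
   (if j == i then - c else 0) *: kill K i 'X_[m])).
  move=> c _; rewrite elem_invX lrmorphZ; case: eqP => _; last by rewrite scale0r addr0.
  by rewrite scaleNr.
apply: (famD rr); first exact: fam_cst.
apply: (famZ rr (a := fun c => if j == i then - c else 0)); case: (j == i).
  by exists 0, (- 'X) => t; rewrite hornerN hornerX expr0 mul1r add0r.
exact: rr_cst rr _.
Qed.

Lemma mcoeff_diagonal f (x : 'I_n -> K) p (M : 'X_{1..n}) :
    (forall l, f 'X_l = x l *: 'X_l) ->
  (f p)@_M = (\prod_l x l ^+ M l) * p@_M.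
Proof.
move=> Hf; rewrite lrmorph_mpolyE raddf_sum /=.
have E (m : 'X_{1..n}) : \prod_i f 'X_i ^+ m i = (\prod_l x l ^+ m l) *: 'X_[m].
  rewrite mpolyXE_id -scaler_prod; apply: eq_bigr => i _.
  by rewrite Hf exprZn.
rewrite (eq_bigr (fun m => (p@_m * \prod_l x l ^+ m l) * (m == M)%:R)).
  have [Mp|Mp] := boolP (M \in msupp p).
    rewrite (bigD1_seq M) ?msupp_uniq //= eqxx mulr1 [X in _ + X]big1.
      by rewrite addr0 mulrC.
    by move=> m /negPf ->; rewrite mulr0.
  rewrite [p@_M]memN_msupp_eq0 // mulr0 big_seq big1 // => m mp.
  by case: eqP => [E'|_]; rewrite ?mulr0 // -E' mp in Mp *.
by move=> m _; rewrite mcoeffZ E mcoeffZ mcoeffX mulrA.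
Qed.

Lemma delta_root j t i m c : t != 0 -> m i = 0%N ->
  delta j t ** U i m c = U i m (t ^ ((m j)%:Z - (j == i)%:Z) * c) ** delta j t.
Proof.
move=> t0 mi; apply: aut_eqX => l; rewrite !aut_mulE.
rewrite [in RHS]deltaX // autZ !root_elemX //.
case: eqP => [->|_]; last by rewrite deltaX.
rewrite lrmorphD autZ deltaX // scalerDr; congr (_ + _).
rewrite scalerA.
have -> : delta j t 'X_[m] = t ^+ m j *: 'X_[m].
  apply/mpolyP => M; rewrite (mcoeff_diagonal _ _ (fun l => deltaX j l t0)).
  rewrite mcoeffZ mcoeffX; case: eqP => [<-|_]; rewrite ?mulr0 // !mulr1.
  rewrite (bigD1 j) //= eqxx big1 ?mulr1 // => a /negPf ->.
  by rewrite expr1n.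
rewrite scalerA; congr (_ *: _); rewrite mulrC mulrA; congr (_ * _).
rewrite [j == i]eq_sym; case: (i == j); last by rewrite subr0 mul1r.
by rewrite expfzDr // mulrCA -[- _%:Z]/(-1) exprN1 mulfV // mulr1.
Qed.

Section Conjugate.
Variables (Phi Psi : NAut K n -> NAut K n).
Hypothesis PhiM : naut_multiplicative Phi.
Hypothesis Phi_ind : ind_morphism Phi.
Hypothesis PhiK : cancel Phi Psi.
Hypothesis Psi_ind : ind_morphism Psi.
Local Notation Ph := (extend Phi).

Definition conjPhi alpha f := aut_inv alpha ** Ph f ** alpha.

Lemma conj_mul alpha f g : nice f -> nice g -> nice (f ** g) ->
  conjPhi alpha (f ** g) = conjPhi alpha f ** conjPhi alpha g.
Proof.
move=> nf ng nfg; rewrite /conjPhi (extend_mul PhiM) //.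
by rewrite !aut_mulA aut_mulKV.
Qed.

Lemma conj_tameM alpha f g : tame f -> tame g ->
  conjPhi alpha (f ** g) = conjPhi alpha f ** conjPhi alpha g.
Proof.
by move=> tf tg; apply: conj_mul; apply: nice_tame => //; apply: tame_mul.
Qed.

Lemma conj_one alpha : conjPhi alpha one = one.
Proof. by rewrite /conjPhi extend_one // aut_mul1 aut_Vmul. Qed.

Lemma conj_inv alpha f : tame f ->
  conjPhi alpha (aut_inv f) = aut_inv (conjPhi alpha f).
Proof.
move=> tf; apply/esym/aut_inv_eq; rewrite -conj_tameM //; last exact: tame_inv.
by rewrite aut_mulV conj_one.
Qed.

Lemma conj_inj alpha f g : nice f -> nice g ->
  conjPhi alpha f = conjPhi alpha g -> f = g.
Proof.
move=> nf ng; rewrite /conjPhi => /aut_Imul /aut_mulI.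
exact: (extend_inj (can_inj PhiK)).
Qed.

Lemma conj_fam alpha S A (rrA : regular_ring S A) (g : K -> polyAut K n) :
    (forall t, nice (g t)) ->
    (forall i, fam S A (fun t => g t 'X_i)) ->
    (forall i, fam S A (fun t => aut_inv (g t) 'X_i)) ->
  forall i, fam S A (fun t => conjPhi alpha (g t) 'X_i).
Proof.
move=> ng Hg Hg' i.
apply: (fam_app rrA (f := fun=> aut_inv alpha) (F := fun t => Ph (g t) (alpha 'X_i))).
  by move=> l; apply: fam_cst.
apply: (fam_app rrA (f := fun t => Ph (g t))); last exact: fam_cst.
exact: (extend_fam rrA).
Qed.

Variables (alpha : polyAut K n) (w : 'I_n -> W).
Hypothesis w_unit : wt_mx w \in unitmx.
Local Notation C := (conjPhi alpha).
Hypothesis torus : forall j t i, t != 0 ->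
  C (delta j t) 'X_i = t ^ (w i 0 j) *: 'X_i.
Variables (i : 'I_n) (m : 'X_{1..n}).
Hypothesis mi : m i = 0%N.
Let V c := C (U i m c).

Lemma VD c c' : V (c + c') = V c ** V c'.
Proof. by rewrite /V root_elemD conj_tameM //; apply: tame_root. Qed.

Lemma V0 : V 0 = one. Proof. by rewrite /V root_elem0 conj_one. Qed.

Lemma V_eq1 c : V c = one -> c = 0.
Proof.
rewrite -V0 => /conj_inj E; rewrite -(root_elem_coef c mi) E.
- by rewrite root_elem_coef.
- by apply/nice_tame/tame_root.
by apply/nice_tame/tame_root.
Qed.

Lemma V_fam k : fam (fun=> True) (@poly_gap K 0) (fun c => V c 'X_k).
Proof.
apply: (conj_fam alpha (poly_gap_ring K 0)) => [t|l|l]; first exact/nice_tame/tame_root.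
  exact: fam_root.
exact: fam_root_inv.
Qed.

Lemma V_poly k M : exists q : {poly K}, forall c, (V c 'X_k)@_M = q.[c].
Proof. by have [_ /(_ M) /poly_gapP] := V_fam k. Qed.

Lemma V_torus j t c k M : t != 0 ->
  (\prod_l (t ^ (w l 0 j)) ^+ M l) * (V c 'X_k)@_M =
    t ^ (w k 0 j) * (V (t ^ ((m j)%:Z - (j == i)%:Z) * c) 'X_k)@_M.
Proof.
move=> t0; rewrite -(mcoeff_diagonal _ _ (f := C (delta j t))); last first.
  by move=> l; apply: torus.
have td : tame (delta j t) by apply: tame_diag.
have E : C (delta j t) ** V c =
    V (t ^ ((m j)%:Z - (j == i)%:Z) * c) ** C (delta j t).
  by rewrite /V -!conj_tameM ?delta_root //; apply: tame_root.
by rewrite -[C (delta j t) _]/((C (delta j t) ** V c) 'X_k) E aut_mulE torus //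
  autZ mcoeffZ.
Qed.

(** Compare the coefficients of [c^e] in [V_torus]: the same nonzero scalar is multiplied by two
    powers of [t], whose exponents must agree for every [j]. *)
Lemma V_weight k M e (q : {poly K}) : (forall c, (V c 'X_k)@_M = q.[c]) ->
  q`_e != 0 -> root_wt k M *m wt_mx w = e%:R *: root_wt i m.
Proof.
move=> Hq qe; apply/rowP => j.
pose r := (m j)%:Z - (j == i)%:Z; pose u := \sum_l w l 0 j * (M l)%:Z.
suff E : u = w k 0 j + r * e%:Z.
  have /(congr1 (intr : int -> rat)) := E; rewrite /u /r.
  rewrite rmorph_sum rmorphD rmorphM rmorphB /= => E'.
  rewrite !mxE; transitivity (\sum_l (w l 0 j * (M l)%:Z)%:~R - (w k 0 j)%:~R : rat).
    rewrite (bigD1 k) //= [in RHS](bigD1 k) //= !mxE eqxx.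
    rewrite mulrBl mul1r -addrA [- _ + _]addrC addrA rmorphM mulrC; congr (_ + _ - _).
    by apply: eq_bigr => l /negPf lk; rewrite !mxE lk subr0 mulrC rmorphM.
  by rewrite E' addrAC subrr add0r mulrC.
apply/eqP/negPn/negP => ne; have [t t0 /eqP] := @exprz_neq K _ _ ne; apply.
have Eu : t ^ u = \prod_l (t ^ (w l 0 j)) ^+ M l.
  rewrite /u; elim: (index_enum _) => [|l s IH]; first by rewrite !big_nil expr0z.
  by rewrite !big_cons expfzDr // IH -exprz_exp -exprnP.
pose P := \poly_(a < size q) (t ^ u * q`_a - t ^ (w k 0 j) * (q`_a * (t ^ r) ^+ a)).
have P0 : P = 0.
  apply: poly_eq0_horner => c; have := V_torus j c k M t0.
  rewrite -Eu !Hq => /eqP; rewrite -subr_eq0 => /eqP E; rewrite -[RHS]E.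
  rewrite horner_poly !horner_coef !mulr_sumr -sumrB; apply: eq_bigr => a _.
  by rewrite exprMn mulrBl -!mulrA.
have eq_sz : (e < size q)%N.
  by rewrite ltnNge; apply: contra qe => /leq_sizeP -> //.
have := congr1 (fun s : {poly K} => s`_e) P0; rewrite coef_poly eq_sz coef0.
move/eqP; rewrite [q`_e * _]mulrC mulrA -mulrBl mulf_eq0 (negPf qe) orbF subr_eq0.
by move/eqP=> ->; rewrite [RHS]expfzDr // -exprz_exp -exprnP.
Qed.

(** For every term [c^e X^M] of [V c 'X_k] the vector M - e_k equals [e] times [mu] ([V_mu]), so all
    these vectors lie on one ray. *)
Let mu := root_wt i m *m invmx (wt_mx w).

Lemma V_mu k M e (q : {poly K}) : (forall c, (V c 'X_k)@_M = q.[c]) ->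
  q`_e != 0 -> forall l, (M l)%:R - (l == k)%:R = e%:R * mu 0 l.
Proof.
move=> Hq qe l; have E := V_weight Hq qe.
have : root_wt k M = e%:R *: mu by rewrite /mu scalemxAl -E mulmxK.
by move/rowP/(_ l); rewrite !mxE.
Qed.

Lemma mu_neq0 : exists l, mu 0 l != 0.
Proof.
apply/rV0Pn/eqP => mu0; have /rowP/(_ i) : root_wt i m = 0.
  by rewrite -[LHS](mulmxKV w_unit) -/mu mu0 mul0mx.
by rewrite !mxE mi eqxx sub0r => /eqP; rewrite oppr_eq0 oner_eq0.
Qed.

(** For M = e_k, [V_mu] reads [e mu = 0], so this coefficient does not depend on [c]; at [c = 0] it
    is 1. *)
Lemma V_lin_coef k c : (V c 'X_k)@_U_(k) = 1.
Proof.
have [q Hq] := V_poly k U_(k)%MM.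
have q1 : q.[0] = 1 by rewrite -Hq V0 -[one 'X_k]/('X_k) mcoeffXU eqxx.
rewrite Hq -q1 [q]size1_polyC ?hornerC //.
apply/leq_sizeP => e e0; apply/eqP/negPn/negP => qe.
have [l] := mu_neq0; have /eqP := V_mu Hq qe l.
rewrite mnm1E [k == l]eq_sym subrr eq_sym mulf_eq0 pnatr_eq0.
by case/orP=> [/eqP E|->//]; rewrite E in e0.
Qed.

Lemma V_exp_gt0 k M e (q : {poly K}) : (forall c, (V c 'X_k)@_M = q.[c]) ->
  q`_e != 0 -> M k = 0%N -> (0 < e)%N /\ mu 0 k = - e%:R^-1.
Proof.
move=> Hq qe Mk; have := V_mu Hq qe k; rewrite Mk eqxx sub0r => E.
have e0 : (0 < e)%N.
  by rewrite lt0n; apply: contra_eqN E => /eqP ->; rewrite mul0r oppr_eq0 oner_eq0.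
split=> //; have e0' : e%:R != 0 :> rat by rewrite pnatr_eq0 -lt0n.
by apply: (mulfI e0'); rewrite -E mulrN mulfV.
Qed.

(** If [x_k] divides [V c 'X_k] for all [c], the cofactor is a unit because [V (- c)] inverts [V c].
    It is thus a constant, equal to 1 by [V_lin_coef]. *)
Lemma V_fixX k : (forall c M, (V c 'X_k)@_M != 0 -> M k != 0%N) ->
  forall c, V c 'X_k = 'X_k.
Proof.
move=> H.
have dvd c : exists Q, V c 'X_k = 'X_k * Q.
  exists (\sum_(M <- msupp (V c 'X_k)) (V c 'X_k)@_M *: 'X_[M - U_(k)]).
  rewrite [LHS]mpolyE mulr_sumr; apply: eq_big_seq => M.
  rewrite mcoeff_msupp => /H Mk; rewrite -scalerAr -mpolyXD addmC submK //.
  by rewrite lep1mP.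
move=> c; have [Q EQ] := dvd c; have [Q' EQ'] := dvd (- c).
have : Q' * V (- c) Q = 1.
  have X0 : 'X_k != 0 :> R.
    by rewrite -msize_poly_eq0 msizeX.
  apply: (mulfI X0); rewrite mulr1 mulrA -EQ' -lrmorphM -EQ.
  by rewrite -[LHS]/((V (- c) ** V c) 'X_k) -VD addNr V0.
move=> E; have : V (- c) Q \is a GRing.unit by apply/unitrP; exists Q'; split=> //; rewrite mulrC.
case/andP=> /eqP EV _; set b := (V (- c) Q)@_0 in EV.
have Qb : Q = b%:MP.
  by rewrite -[LHS]/(one Q) -V0 -(subrr c) VD aut_mulE EV autC.
have := V_lin_coef k c; rewrite EQ Qb mulrC mul_mpolyC mcoeffZ mcoeffXU eqxx mulr1.
by move=> ->; rewrite scale1r.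
Qed.

(* Only one variable can be moved: moving [x_k] requires a monomial free of
   [x_k], hence [mu 0 k < 0], which forbids [x_k] in the other images. *)
Lemma V_root : exists k (M : 'X_{1..n}) a e, [/\ a != 0, (0 < e)%N, M k = 0%N,
  root_wt k M *m wt_mx w = e%:R *: root_wt i m & forall c, V c = U k M (a * c ^+ e)].
Proof.
(* If no variable had a monomial free of it in its image, [V_fixX] would make [V 1] the identity. *)
have [k [c0 [M Mk Mc0]]] : exists k c, exists2 M : 'X_{1..n}, M k = 0%N & (V c 'X_k)@_M != 0.
  apply: NNPP => H; have V1 : V 1 = one.
    apply: aut_eqX => k; apply: V_fixX => c M cM; apply/eqP => Mk; apply: H.
    by exists k, c, M.
  by have /eqP := V_eq1 V1; rewrite oner_eq0.
have [q Hq] := V_poly k M.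
have [e qe] : exists e, q`_e != 0.
  have q0 : q != 0 by apply: contraNneq Mc0 => q0; rewrite Hq q0 horner0.
  by exists (size q).-1; rewrite -lead_coefE lead_coef_eq0.
have [e0 muk] := V_exp_gt0 Hq qe Mk.
(* The k-th entry of [mu] is negative, so no positive multiple of it is a natural number. *)
have muN (a b : nat) : (0 < b)%N -> a%:R != b%:R * mu 0 k.
  move=> b0; rewrite muk mulrN; apply/eqP => E.
  have : 0 < b%:R / e%:R :> rat by rewrite divr_gt0 // ltr0n.
  by rewrite -oppr_lt0 -E ltrn0.
have other l c : l != k -> V c 'X_l = 'X_l.
  move=> lk; apply: V_fixX => {}c N cN; apply/eqP => Nl.
  have [q' Hq'] := V_poly l N.
  have [e' qe'] : exists e, q'`_e != 0.
    have q0 : q' != 0 by apply: contraNneq cN => q0; rewrite Hq' q0 horner0.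
    by exists (size q').-1; rewrite -lead_coefE lead_coef_eq0.
  have [e'0 _] := V_exp_gt0 Hq' qe' Nl.
  have := V_mu Hq' qe' k; rewrite eq_sym (negPf lk) subr0 => /eqP.
  exact/negP/muN.
(* A term other than ['X_k] is free of [x_k] by [muN]. The k-th entry of [mu] then determines its
   exponent in [c], and [V_mu] its monomial. *)
have only N (q' : {poly K}) e' : (forall c, (V c 'X_k)@_N = q'.[c]) -> N != U_(k)%MM ->
    q'`_e' != 0 -> e' = e /\ N = M.
  move=> Hq' NU qe'.
  have e'0 : (0 < e')%N.
    rewrite lt0n; apply: contra NU => /eqP e'0; apply/eqP/mnmP => l.
    have /eqP := V_mu Hq' qe' l; rewrite e'0 mul0r subr_eq0 eqr_nat.
    by move/eqP => ->; rewrite mnm1E eq_sym.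
  have Nk : N k = 0%N.
    apply/eqP; rewrite -[_ == _]negbK -lt0n; apply/negP => Nk.
    have := V_mu Hq' qe' k; rewrite eqxx -natrB // => /eqP.
    exact/negP/muN.
  have [_ muk'] := V_exp_gt0 Hq' qe' Nk.
  have Ee : e' = e.
    apply/eqP; rewrite -(eqr_nat rat); apply/eqP/invr_inj/oppr_inj.
    by rewrite -muk -muk'.
  split=> //; apply/mnmP => l; apply/eqP; rewrite -(eqr_nat rat).
  rewrite -(inj_eq (addIr (- (l == k)%:R))) (V_mu Hq qe) (V_mu Hq' qe') Ee.
  by rewrite eqxx.
have MU : M != U_(k)%MM by rewrite eq_sym mnm_neqU.
have Eq c : q.[c] = q`_e * c ^+ e.
  rewrite horner_coef; have es : (e < size q)%N.
    by rewrite ltnNge; apply: contra qe => /leq_sizeP -> //.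
  rewrite (bigD1 (Ordinal es)) //= big1 ?addr0 // => a ae.
  have [->|qa] := eqVneq q`_a 0; first by rewrite mul0r.
  by have [E _] := only M q a Hq MU qa; rewrite -val_eqE /= E eqxx in ae.
exists k, M, q`_e, e; split=> //; first exact: V_weight Hq qe.
move=> c; apply: aut_eqX => l; rewrite root_elemX //.
case: eqP => [->|/eqP /other -> //]; apply/mpolyP => N.
rewrite mcoeffD mcoeffZ !mcoeffX.
have [NU|NU] := eqVneq U_(k)%MM N.
  by rewrite -NU V_lin_coef (negPf MU) mulr0 addr0.
rewrite add0r; have [E|MN] := eqVneq M N; first by rewrite -E Hq Eq mulr1.
have [q' Hq'] := V_poly k N; rewrite mulr0 Hq'.
suff -> : q' = 0 by rewrite horner0.
apply/polyP => e'; rewrite coef0; apply/eqP/negPn/negP => qe'.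
have [|_ E] := only N q' e' Hq' _ qe'; first by rewrite eq_sym.
by rewrite E eqxx in MN.
Qed.

Lemma extend_nice f : nice (Ph f).
Proof.
rewrite /extend; case: excluded_middle_informative => [nf|_]; first exact: nvalP.
exact: nice_one.
Qed.

Lemma extend_can f : nice f -> extend Psi (Ph f) = f.
Proof.
by move=> nf; rewrite -[f]/(nval (MkNAut nf)) !extendE PhiK.
Qed.

(* The exponent [e] is 1 because [Psi] is a morphism too: in characteristic p
   it could otherwise be a power of p. *)
Lemma conj_root : exists k (M : 'X_{1..n}) a, [/\ a != 0, M k = 0%N,
  root_wt k M *m wt_mx w = root_wt i m & forall c, C (U i m c) = U k M (a * c)].
Proof.
have [k [M [a [e [a0 e0 Mk Hroot HV]]]]] := V_root.
suff e1 : e = 1%N.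
  exists k, M, a; split=> //; first by rewrite Hroot e1 scale1r.
  by move=> c; rewrite -[LHS]/(V c) HV e1 expr1.
(* The image subgroup with a linear parameter. Each [b] is some [a * c ^+ e] since [K] is
   algebraically closed, so each [g b] is in the image of [Phi] and [Psi] can be applied along this
   curve. *)
pose g b := alpha ** U k M b ** aut_inv alpha.
have gE c : g (a * c ^+ e) = Ph (U i m c).
  by rewrite /g -HV /V /conjPhi !aut_mulA aut_mulV aut_1mul aut_mulKV.
have ng b : nice (g b).
  have [c Hc] : exists c, b = a * c ^+ e.
    have /closed_rootP [c] : size ('X^e - (b / a)%:P) != 1%N.
      by rewrite size_XnsubC // eqSS -lt0n.
    rewrite rootE !hornerE subr_eq0 => /eqP Ec; exists c.
    by rewrite Ec mulrCA mulfV // mulr1.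
  by rewrite Hc gE; apply: extend_nice.
have rr := poly_gap_ring K 0.
have famg (u : K -> polyAut K n) : (forall l, fam (fun=> True) (@poly_gap K 0)
    (fun c => u c 'X_l)) -> forall l, fam (fun=> True) (@poly_gap K 0)
    (fun c => (alpha ** u c ** aut_inv alpha) 'X_l).
  move=> Hu l; apply: (fam_app rr (f := fun=> alpha)
    (F := fun c => u c (aut_inv alpha 'X_l))).
    by move=> l'; apply: fam_cst.
  by apply: (fam_app rr (f := u)) => //; apply: fam_cst.
have Hg := famg _ (fam_root k M).
have Hg' l : fam (fun=> True) (@poly_gap K 0) (fun c => aut_inv (g c) 'X_l).
  apply: (fam_ext rr) (famg _ (fam_root_inv k M) l) => c _.
  by rewrite /g !aut_inv_mul aut_invK aut_mulA.
have [_ /(_ m) /poly_gapP [H HH]] := extend_fam rr Psi_ind ng Hg Hg' i.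
(* [H] reads off the parameter of the preimage of [g b]; composition with [a * c ^+ e] gives back
   [c], and degrees yield [e = 1]. *)
have HX : H \Po (a *: 'X^e) = 'X.
  apply/eqP; rewrite -subr_eq0; apply/eqP/poly_eq0_horner => c.
  rewrite hornerD hornerN horner_comp hornerX hornerZ hornerXn -HH gE extend_can.
    by rewrite root_elem_coef // subrr.
  by apply: nice_tame; apply: tame_root.
have := size_comp_poly H (a *: 'X^e); rewrite HX size_polyX size_scale //.
by rewrite size_polyXn /= => /eqP; rewrite eq_sym muln_eq1 => /andP[_ /eqP].
Qed.
End Conjugate.
End RootSubgroups.

(** * Conjugation to a form that fixes the torus and the translations *)

Section Normalization.
Variables (K : closedFieldType) (n : nat).
Hypothesis n_gt1 : (1 < n)%N.
Local Notation R := {mpoly K[n]}.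
Local Notation W := 'rV[int]_n.
Local Notation "f ** g" := (aut_mul f g) (at level 40, left associativity).
Local Notation one := (aut_one K n).
Implicit Types (f g h : polyAut K n) (p : R) (i j k l : 'I_n) (m M : 'X_{1..n}).
Variables (Phi Psi : NAut K n -> NAut K n).
Hypothesis PhiM : naut_multiplicative Phi.
Hypothesis Phi_ind : ind_morphism Phi.
Hypothesis PhiK : cancel Phi Psi.
Hypothesis Psi_ind : ind_morphism Psi.
Local Notation C := (conjPhi Phi).
Local Notation U := (@root_elem K n).

Lemma conj_conj alpha beta f :
  C (alpha ** beta) f = aut_inv beta ** C alpha f ** beta.
Proof. by rewrite /conjPhi aut_inv_mul !aut_mulA. Qed.

Lemma exists_torus_weights : exists alpha (w : 'I_n -> W),
  wt_mx w \in unitmx /\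
  forall j t i, t != 0 -> C alpha (delta j t) 'X_i = t ^ (w i 0 j) *: 'X_i.
Proof.
have [beta [w [Hw w_unit]]] :=
  linearize (torus_full_grading PhiM Phi_ind (can_inj PhiK)).
exists beta, w; split=> // j t i t0.
by rewrite /conjPhi !aut_mulE (Hw i j t t0) autZ /= aut_funK.
Qed.

Section Permutation.
Variables (alpha : polyAut K n) (w : 'I_n -> W).
Hypothesis w_unit : wt_mx w \in unitmx.
Hypothesis torus : forall j t i, t != 0 ->
  C alpha (delta j t) 'X_i = t ^ (w i 0 j) *: 'X_i.
(** Right multiplication by [N] carries the character of a root subgroup to the character of its
    image ([root_image]). *)
Let N := invmx (wt_mx w).

Lemma root_image i m : m i = 0%N ->
  exists k (M : 'X_{1..n}), M k = 0%N /\ root_wt i m *m N = root_wt k M.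
Proof.
move=> mi; have [k [M [a [_ Mk E _]]]] :=
  conj_root PhiM Phi_ind PhiK Psi_ind w_unit torus mi.
by exists k, M; split=> //; rewrite -E mulmxK.
Qed.

Lemma root_wtN i m l :
  (root_wt i m *m N) 0 l = \sum_j (m j)%:R * N j l - N i l.
Proof.
rewrite mxE (eq_bigr (fun j => (m j)%:R * N j l - (j == i)%:R * N j l)).
  rewrite sumrB; congr (_ - _); rewrite (bigD1 i) //= eqxx mul1r big1 ?addr0 //.
  by move=> j /negPf ->; rewrite mul0r.
by move=> j _; rewrite mxE mulrBl.
Qed.

(** For [i != j], the root c e_j - e_i is sent to a root, whose entries are at least -1. For large
    [c] this excludes a negative entry in row [j]. *)
Lemma N_ge0 j l : (0 <= N j l)%R.
Proof.
have [i ij] : exists i, i != j.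
  apply/existsP; rewrite -[[exists _, _]]negbK negb_exists; apply/negP => /forallP H.
  have /eqP := card_ord n; rewrite (@eq_card1 _ j) => [|i].
    by rewrite eq_sym -(subnKC n_gt1).
  by have := H i; rewrite negbK inE.
rewrite leNgt; apply/negP => Nneg.
pose x := - N j l; have x0 : 0 < x by rewrite /x oppr_gt0.
pose b := (`|1 - N i l| / x).
have b0 : 0 <= b by rewrite divr_ge0 // ltW.
pose c := Num.bound b.
have [|k [M [_ E]]] := @root_image i (U_(j) *+ c)%MM.
  by rewrite mulmnE mnm1E eq_sym (negPf ij).
have := congr1 (fun v : 'rV_n => v 0 l) E; rewrite root_wtN mxE.
rewrite (bigD1 j) //= big1 => [|j' /negPf j'j]; last first.
  by rewrite mulmnE mnm1E eq_sym j'j mul0r.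
rewrite addr0 mulmnE mnm1E eqxx mul1n => Ec.
have : c%:R * x <= 1 - N i l.
  have -> : c%:R * x = (l == k)%:R - (M l)%:R - N i l.
    by rewrite /x mulrN -[c%:R * _](subrK (N i l)) Ec; ring.
  rewrite lerD2r; apply: (@le_trans _ _ (l == k)%:R).
    by rewrite gerBl ler0n.
  by rewrite lern1 leq_b1.
apply/negP; rewrite -ltNge.
apply: (le_lt_trans (ler_norm _)).
by rewrite -ltr_pdivrMr // archi_boundP.
Qed.

(** The root -e_i is sent to M - e_k with [M k = 0], whose entries are nonpositive by [N_ge0]; hence
    [M = 0]. *)
Lemma N_row i : exists k, forall l, N i l = (l == k)%:R.
Proof.
have [k [M [Mk E]]] := @root_image i 0%MM (mnm0E i).
exists k => l; have := congr1 (fun v : 'rV_n => v 0 l) E; rewrite root_wtN mxE.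
rewrite big1 => [|j _]; last by rewrite mnm0E mul0r.
rewrite sub0r => El; have := N_ge0 i l.
have -> : N i l = (l == k)%:R - (M l)%:R by rewrite -[LHS]opprK El opprB.
rewrite subr_ge0 ler_nat; case: eqP => [->|_].
  by rewrite Mk subr0.
by rewrite leqn0 => /eqP ->; rewrite subr0.
Qed.

(** By [N_row] and invertibility, [N] is a permutation matrix, which the permutation [P] of the
    variables undoes. *)
Lemma exists_torus_fixed : exists beta, forall j t, t != 0 ->
  C beta (delta j t) = delta j t.
Proof.
have /fin_all_exists [s Hs] := N_row.
have ws i j : w (s i) 0 j = (i == j)%:Z.
  apply/eqP; rewrite -(eqr_int rat); apply/eqP.
  have /matrixP/(_ i j) := mulVmx w_unit; rewrite !mxE => E.
  rewrite -[RHS]/((i == j)%:R : rat) -E (bigD1 (s i)) //= big1 => [|l ls].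
    by rewrite (Hs i) eqxx mul1r mxE addr0.
  by rewrite (Hs i) (negPf ls) mul0r.
have s_inj : injective s.
  move=> i i' E; have := ws i i; rewrite E ws eqxx; by case: eqP.
have H1 i : subst (fun i => 'X_(invF s_inj i) : R) 'X_(s i) = 'X_i.
  by rewrite substX invF_f.
have H2 i : subst (fun i => 'X_(s i) : R) 'X_(invF s_inj i) = 'X_i.
  by rewrite substX f_invF.
pose P := subst_aut H1 H2.
exists (alpha ** P) => j t t0; apply: aut_eqX => i.
have PX : P 'X_i = 'X_(s i) by exact: substX.
rewrite conj_conj; transitivity (aut_inv P (C alpha (delta j t) (P 'X_i))) => //.
rewrite PX torus // autZ -PX.
rewrite aut_VK.
by rewrite ws deltaX //; case: eqP; rewrite ?expr0z ?expr1z.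
Qed.
End Permutation.

(** When the torus is fixed, a root subgroup and its image have the same character m - e_i. It
    determines [i], the place of its only negative entry, and then [m]. *)
Lemma torus_fixed_root alpha : (forall j t, t != 0 -> C alpha (delta j t) = delta j t) ->
  forall i m, m i = 0%N ->
  exists2 a, a != 0 & forall c, C alpha (U i m c) = U i m (a * c).
Proof.
move=> torus i m mi.
pose w i : W := delta_mx 0 i.
have w1 : wt_mx w = 1%:M.
  by apply/matrixP => a b; rewrite !mxE eqxx /= eq_sym; case: eqP.
have w_unit : wt_mx w \in unitmx by rewrite w1 unitmx1.
have torus' j t l : t != 0 -> C alpha (delta j t) 'X_l = t ^ (w l 0 j) *: 'X_l.
  move=> t0; rewrite torus // deltaX // mxE eqxx /= eq_sym.
  by case: eqP; rewrite ?expr0z ?expr1z.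
have [k [M [a [a0 Mk E HC]]]] := conj_root PhiM Phi_ind PhiK Psi_ind w_unit torus' mi.
rewrite w1 mulmx1 in E.
have El l : (M l)%:R - (l == k)%:R = (m l)%:R - (l == i)%:R :> rat.
  by have := congr1 (fun v : 'rV_n => v 0 l) E; rewrite !mxE.
have Ek : k = i.
  have /eqP := El k; rewrite Mk eqxx sub0r eq_sym subr_eq addrC -subr_eq opprK.
  rewrite -natrD eqr_nat addn1.
  by case: (k =P i).
have EM : M = m.
  apply/mnmP => l; apply/eqP; rewrite -(eqr_nat rat).
  by have := El l; rewrite Ek => /addIr ->.
by exists a => // c; rewrite HC Ek EM.
Qed.

Lemma root_elem_cst i c : U i 0%MM c = elem i c%:MP.
Proof. by rewrite /root_elem mpolyX0 alg_mpolyC. Qed.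

Lemma exists_normalization : exists alpha,
  (forall j t, t != 0 -> C alpha (delta j t) = delta j t) /\
  (forall i c, C alpha (elem i c%:MP) = elem i c%:MP).
Proof.
have [alpha0 [w [w_unit torus0]]] := exists_torus_weights.
have [alpha torus] := exists_torus_fixed w_unit torus0.
have H i : exists a, a != 0 /\ forall c, C alpha (U i 0%MM c) = U i 0%MM (a * c).
  by have [a a0 Ha] := torus_fixed_root torus (mnm0E i); exists a.
have /fin_all_exists [a Ha] := H.
(* Rescaling the variables by [D] turns the parameter [a i * c] of the i-th translation subgroup
   back into [c]. *)
pose D := diag (fun i => (a i)^-1).
exists (alpha ** D); split=> [j t t0|i c].
  by rewrite conj_conj torus // -aut_mulA diagC aut_mulA aut_Vmul aut_1mul.
have [a0 HC] := Ha i.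
apply: (@aut_mulI _ _ D); rewrite conj_conj -!root_elem_cst HC.
rewrite !aut_mulA aut_mulV aut_1mul; apply: aut_eqX => l; rewrite !aut_mulE diagX.
rewrite unzE ?invr_eq0 ?(Ha l).1 // autZ !root_elemX ?mnm0E //.
case: eqP => [->|_]; last by rewrite diagX unzE // invr_eq0 (Ha l).1.
rewrite lrmorphD diagX unzE ?invr_eq0 // scalerDr scalerA mulKf // autZ.
by rewrite mpolyX0 rmorph1.
Qed.
End Normalization.

(** * Rigidity: the normalized map is the identity on tame, then on nice automorphisms *)

Section Rigidity.
Variables (K : closedFieldType) (n : nat).
Local Notation R := {mpoly K[n]}.
Local Notation "f ** g" := (aut_mul f g) (at level 40, left associativity).
Local Notation one := (aut_one K n).
Implicit Types (f g h : polyAut K n) (p P Q : R) (i j k l : 'I_n) (m M : 'X_{1..n}).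
Variable Phi : NAut K n -> NAut K n.
Hypothesis PhiM : naut_multiplicative Phi.
Hypothesis Phi_ind : ind_morphism Phi.
Variable alpha : polyAut K n.
Local Notation C := (conjPhi Phi alpha).
Local Notation U := (@root_elem K n).
Hypothesis C_delta : forall j t, t != 0 -> C (delta j t) = delta j t.
Hypothesis C_cst : forall i c, C (elem i c%:MP) = elem i c%:MP.
Hypothesis C_root : forall i m, m i = 0%N ->
  exists2 a, a != 0 & forall c, C (U i m c) = U i m (a * c).

Lemma C_transl v : C (transl v) = transl v.
Proof.
suff [] : tame (transl v) /\ C (transl v) = transl v by [].
apply: (transl_ind (G := fun f => tame f /\ C f = f)) => [|f g [tf Cf] [tg Cg]|i c].
- by split; [exact: tame_one | exact: conj_one].
- by split; [exact: tame_mul | rewrite conj_tameM // Cf Cg].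
by split; [exact: tame_elem | exact: C_cst].
Qed.

Lemma C_diag (s : 'I_n -> K) : (forall i, s i != 0) -> C (diag s) = diag s.
Proof.
apply: (diag_ind (G := fun f => C f = f)); first exact: conj_one.
move=> f j t t0 Cf tf; rewrite conj_tameM ?Cf ?C_delta //.
exact: tame_diag.
Qed.

Lemma kill0 i p : (kill K i p)@_0 = p@_0.
Proof.
rewrite lrmorph_mpolyE [in RHS](mpolyE p) !raddf_sum /=; apply: eq_bigr => m _.
rewrite !mcoeffZ; congr (_ * _); rewrite mcoeffX.
have [->|m0] := eqVneq m 0%MM.
  by rewrite big1 ?mcoeff1 ?eqxx // => j _; rewrite mnm0E expr0.
have [j mj] : exists j, m j != 0%N.
  apply/existsP; apply: contraNT m0; rewrite negb_exists => /forallP H.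
  by apply/eqP/mnmP => j; rewrite mnm0E; apply/eqP; have := H j; rewrite negbK.
rewrite rmorph_prod (bigD1 j) //= rmorphXn /= substX.
have -> : (if j == i then 0 else 'X_j : R)@_0 = 0.
  by case: eqP => _; rewrite ?mcoeff0 // mcoeffX mnm1_eq0.
by rewrite expr0n (negPf mj) mul0r.
Qed.

Lemma elem_eq1 i m (c : K) : m i != 0%N -> elem i (c *: 'X_[m]) = one.
Proof.
move=> mi; apply: aut_eqX => j; rewrite elemX; case: eqP => // ->.
rewrite lrmorphZ [X in kill K i X]mpolyXE_id rmorph_prod (bigD1 i) //= rmorphXn /=.
rewrite substX eqxx.
by rewrite expr0n (negPf mi) mul0r scaler0 addr0.
Qed.

(** [C] rescales the coefficients of nonconstant monomials free of [x_i] and fixes the constant one;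
    monomials containing [x_i] are ignored by [elem i]. *)
Lemma C_elem_coef0 i Q : exists Q', C (elem i Q) = elem i Q' /\ Q'@_0 = Q@_0.
Proof.
elim/mpolyind: Q => [|c m p _ _ [p' [Cp p0]]].
  by exists 0; rewrite elem0 conj_one.
have elemD_C q q' : C (elem i (q + q')) = C (elem i q) ** C (elem i q').
  by rewrite elemD conj_tameM //; apply: tame_elem.
have [mi|mi] := eqVneq (m i) 0%N; last first.
  exists p'; split.
    rewrite elemD_C Cp (elem_eq1 c mi).
    by transitivity (one ** elem i p'); rewrite ?conj_one ?aut_1mul.
  rewrite mcoeffD mcoeffZ mcoeffX p0; case: eqP => [E|_]; last by rewrite mulr0 add0r.
  by rewrite E mnm0E eqxx in mi.
have [m0|m0] := eqVneq m 0%MM.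
  exists (c *: 'X_[m] + p'); rewrite elemD_C Cp m0 mpolyX0 alg_mpolyC C_cst elemD.
  by rewrite !mcoeffD p0.
have [a _ Ha] := C_root mi.
exists ((a * c) *: 'X_[m] + p'); split.
  by rewrite elemD_C Cp -/(U i m c) Ha elemD.
by rewrite !mcoeffD !mcoeffZ !mcoeffX (negPf m0) !mulr0 p0.
Qed.

(* Conjugating by the translation by 1 of the other variables turns [X^m]
   into a polynomial with constant term 1, so the scaling factor of
   [U i m] is that of [U i 0], which is 1. *)
Lemma C_root_fixed i m c : m i = 0%N -> C (U i m c) = U i m c.
Proof.
move=> mi; have [a _ Ha] := C_root mi.
suff a1 : a = 1 by rewrite Ha a1 mul1r.
(* There is no shift along [x_i], so that [tau] commutes with [kill K i] and conjugates [elem i p]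
   to [elem i (tau p)]. *)
pose v j : K := if j == i then 0 else 1.
pose tau := transl v.
have kill_tau p : kill K i (tau p) = tau (kill K i p).
  apply: (@lrmorph_eqX _ _ (kill K i \o aut_fun tau) (aut_fun tau \o kill K i)) => j.
  change (kill K i (tau 'X_j) = tau (kill K i 'X_j)).
  rewrite translX lrmorphD lrmorphC !substX /v.
  case: eqP => [_|/eqP ji]; first by rewrite rmorph0 addr0 rmorph0.
  by rewrite translX /v (negPf ji).
have conj_tau p : tau ** elem i p = elem i (tau p) ** tau.
  apply: aut_eqX => j; rewrite !aut_mulE elemX.
  have -> : tau 'X_j = 'X_j + (v j)%:MP by exact: translX.
  rewrite lrmorphD lrmorphC elemX kill_tau; have [->|ji] := eqVneq j i.
    by rewrite lrmorphD translX /v eqxx rmorph0 !addr0.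
  exact: translX.
have [Q' [CQ' Q'0]] := C_elem_coef0 i (tau 'X_[m]).
have E : elem i (tau (a *: 'X_[m])) = elem i Q'.
  have te : tame (elem i 'X_[m] : polyAut K n) by exact: tame_elem.
  have tt : tame tau by exact: tame_transl.
  have Ctau : C tau = tau by apply: C_transl.
  have E1 : C (elem i (tau 'X_[m])) ** tau = tau ** C (elem i 'X_[m]).
    rewrite -[X in _ ** X = _]Ctau -conj_tameM //; last exact: tame_elem.
    by rewrite -conj_tau conj_tameM // Ctau.
  rewrite -CQ'; apply: (@aut_Imul _ _ tau); rewrite E1 -conj_tau; congr (_ ** _).
  by have := Ha 1; rewrite /root_elem mulr1 scale1r => ->.
have tau0 : (tau 'X_[m])@_0 = 1.
  rewrite mpolyXE_id rmorph_prod rmorph_prod big1 // => j _.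
  rewrite !rmorphXn /= translX mcoeffD mcoeffX mnm1_eq0 mcoeffC eqxx mulr1 add0r /v.
  by case: eqP => [->|_]; rewrite ?mi ?expr0 ?expr1n.
have := congr1 (fun f : polyAut K n => (f 'X_i)@_0) E.
by rewrite !elemX eqxx !mcoeffD => /addrI; rewrite !kill0 Q'0 autZ mcoeffZ tau0 mulr1.
Qed.

Lemma C_elem i P : C (elem i P) = elem i P.
Proof.
elim/mpolyind: P => [|c m p _ _ Cp]; first by rewrite elem0 conj_one.
rewrite elemD conj_tameM ?Cp //; try exact: tame_elem.
congr (_ ** _); have [mi|mi] := eqVneq (m i) 0%N; first exact: C_root_fixed.
by rewrite (elem_eq1 c mi) conj_one.
Qed.

Lemma C_elementary f : elementary_aut f -> C f = f.
Proof.
move=> [i [P [HP fi fj]]]; suff -> : f = elem i P by apply: C_elem.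
apply: aut_eqX => j; rewrite elemX kill_id //.
by case: eqP => [->|/eqP /fj].
Qed.

Lemma intertwine f g h h' : f ** h = h' ** f -> g ** h = h' ** g ->
  (f ** aut_inv g) ** h' = h' ** (f ** aut_inv g).
Proof.
move=> fh gh; have E : aut_inv g ** h' = h ** aut_inv g.
  by apply: (@aut_mulI _ _ g); rewrite !aut_mulA aut_mulV aut_1mul gh aut_mulKV.
by rewrite -aut_mulA E !aut_mulA fh.
Qed.

(* [C f] and [f] act in the same way on translations and homotheties, and
   only the identity commutes with all of these. *)
Lemma C_linear f : linear_aut f -> C f = f.
Proof.
move=> Hf; have tf : tame f by apply: tame_linear.
have [A HA] := Hf.
apply: (@aut_Imul _ _ (aut_inv f)); rewrite aut_mulV.
set h := C f ** aut_inv f.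
have h_scal t : t != 0 -> h ** diag (fun=> t) = diag (fun=> t) ** h.
  move=> t0.
  have fs : f ** diag (fun=> t) = diag (fun=> t) ** f.
    apply: aut_eqX => i; rewrite !aut_mulE diagX autZ HA.
    rewrite scaler_sumr rmorph_sum; apply: eq_bigr => j _.
    by rewrite [RHS]autZ diagX !scalerA mulrC.
  have Cfs : C f ** diag (fun=> t) = diag (fun=> t) ** C f.
    rewrite -{1}[diag _]C_diag // -conj_tameM ?fs //; last exact: tame_diag.
    by rewrite conj_tameM // ?C_diag //; apply: tame_diag.
  exact: intertwine Cfs fs.
have h_transl (u : 'I_n -> K) : h ** transl u = transl u ** h.
  pose v i := \sum_j A i j * u j.
  have fv : f ** transl v = transl u ** f.
    apply: aut_eqX => i; rewrite !aut_mulE translX lrmorphD autC HA.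
    rewrite rmorph_sum /v rmorph_sum -big_split; apply: eq_bigr => j _ /=.
    by rewrite autZ translX scalerDr rmorphM mul_mpolyC.
  have Cfv : C f ** transl v = transl u ** C f.
    rewrite -{1}[transl v]C_transl -conj_tameM ?fv //; last exact: tame_transl.
    by rewrite conj_tameM // ?C_transl //; apply: tame_transl.
  exact: intertwine Cfv fv.
move: h h_scal h_transl => h h_scal h_transl; apply: aut_eqX => i; set q := h 'X_i.
(* Commutation with homotheties makes [q] homogeneous of degree 1. *)
have q_lin M : q@_M != 0 -> mdeg M = 1%N.
  move=> qM; apply/eqP; rewrite -eqz_nat; apply/negPn/negP => ne.
  have [t t0 /eqP] := @exprz_neq K _ _ ne; apply.
  have : (h (diag (fun=> t) 'X_i))@_M = (diag (fun=> t) q)@_M.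
    by rewrite -[h (diag _ _)]/((h ** diag _) 'X_i) h_scal.
  rewrite diagX unzE // autZ -/q mcoeffZ.
  rewrite (mcoeff_diagonal q M (x := fun=> t)) => [|l]; last by rewrite diagX unzE.
  move/(mulIf qM); rewrite prodrXr -mdegE => Et.
  by rewrite expr1z -[LHS]/(t ^+ mdeg M) -Et.
have q0 : q@_0 = 0.
  by apply/eqP/negPn/negP => /q_lin; rewrite mdeg0.
have qE : q = \sum_j q@_U_(j) *: 'X_j.
  apply/mpolyP => M; rewrite raddf_sum /=.
  have [qM|qM] := eqVneq q@_M 0.
    rewrite qM big1 // => j _; rewrite mcoeffZ mcoeffX.
    by case: eqP => [E|_]; rewrite ?mulr0 // E qM mul0r.
  have /eqP/mdeg1P [j /eqP ->] := q_lin M qM.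
  rewrite (bigD1 j) //= big1 => [|l /negPf lj].
    by rewrite mcoeffZ mcoeffXU eqxx mulr1 addr0.
  by rewrite mcoeffZ mcoeffXU lj mulr0.
suff Hq j : q@_U_(j) = (i == j)%:R.
  rewrite qE (bigD1 i) //= big1 => [|j /negPf ji].
    by rewrite Hq eqxx scale1r addr0.
  by rewrite Hq eq_sym ji scale0r.
(* Commutation with the unit translation along [x_j] yields the coefficient of ['X_j] in [q]. *)
pose u l : K := (l == j)%:R.
have : (h (transl u 'X_i))@_0 = (transl u q)@_0.
  by rewrite -[h (transl _ _)]/((h ** transl _) 'X_i) h_transl.
rewrite translX lrmorphD autC -/q mcoeffD q0 add0r mcoeffC eqxx mulr1.
move=> Eu; rewrite -[RHS]/(u i) Eu [X in transl u X]qE rmorph_sum raddf_sum.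
rewrite (bigD1 j) //= big1 => [|l lj].
  by rewrite autZ translX mcoeffZ mcoeffD mcoeffX mnm1_eq0 mcoeffC /u !eqxx !mulr1
    add0r mulr1 addr0.
rewrite autZ translX mcoeffZ mcoeffD mcoeffX mnm1_eq0 mcoeffC /u (negPf lj).
by rewrite mul0r addr0 mulr0.
Qed.

Lemma C_tame f : tame f -> C f = f.
Proof.
elim=> {f} [f||| f g tf Cf tg Cg|f tf Cf].
- exact: C_linear.
- exact: C_elementary.
- exact: conj_one.
- by rewrite conj_tameM // Cf Cg.
- by rewrite conj_inv // Cf.
Qed.

(** The polynomials that [f] fixes up to order [k] form a subalgebra. *)
Lemma ordge_fix (k : nat) (f : {lrmorphism R -> R}) p :
  (forall i, ordge k (f 'X_i - 'X_i)) -> ordge k (f p - p).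
Proof.
move=> Hf; pose G q := ordge k (f q - q).
have GC c : G c%:MP by rewrite /G lrmorphC subrr; apply: ordge_cst.
have GD q q' : G q -> G q' -> G (q + q').
  by rewrite /G lrmorphD opprD addrACA; apply: ordgeD.
have GM q q' : G q -> G q' -> G (q * q').
  rewrite /G lrmorphM => Gq Gq'.
  have -> : f q * f q' - q * q' = (f q - q) * f q' + q * (f q' - q') by ring.
  apply: ordgeD; first by rewrite -[k]addn0; apply: ordgeM.
  by rewrite -[k]add0n; apply: ordgeM.
rewrite -/(G p) [p]mpolyE.
apply: big_ind; [exact: (GC 0) | exact: GD | move=> m _].
rewrite -mul_mpolyC mpolyXE_id; apply: (GM) => //.
apply: big_ind; [exact: (GC 1) | exact: GM | move=> i _].
by elim: (m i) => [|e IH]; rewrite ?expr0 ?exprS;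
  [exact: (GC 1) | exact: GM (Hf i) IH].
Qed.

(* The curve of conjugates of [psi] by homotheties extends to t = 0 by the
   identity, with coordinates in the ring of the c + t^d q(t). *)
Lemma C_preserves_order d (psi : polyAut K n) : (0 < d)%N -> nice psi ->
    (forall i, ordge d.+1 (psi 'X_i - 'X_i)) ->
  forall i, ordge d.+1 (C psi 'X_i - 'X_i).
Proof.
move=> d0 npsi Hpsi.
pose s t := diag (fun _ : 'I_n => (t : K)).
pose g t := if t == 0 then one else s t ** psi ** aut_inv (s t).
have ns t : nice (s t ** psi) by apply: nice_diag_mul.
have ts t : tame (s t) by apply: tame_diag.
have ng t : nice (g t).
  rewrite /g; case: eqP => _; first exact: nice_one.
  by apply: nice_mul_tame => //; apply: tame_inv.
have rr := poly_gap_ring K d.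
(* Conjugation by the homothety multiplies a coefficient of degree [e] by [t^(e-1)]. Apart from
   ['X_i] only degrees [e > d] occur, so every exponent of [t] is at least [d]. *)
have fam_conj (phi : polyAut K n) : (forall i, ordge d.+1 (phi 'X_i - 'X_i)) ->
    forall i, fam (fun=> True) (@poly_gap K d) (fun t =>
      (if t == 0 then one else s t ** phi ** aut_inv (s t)) 'X_i).
  move=> Hphi i; pose q := phi 'X_i - 'X_i.
  apply: (fam_ext rr (F := fun t => 'X_i + \sum_(M <- msupp q)
      (if (d < mdeg M)%N then t ^+ (mdeg M).-1 * q@_M else 0) *: 'X_[M])).
    move=> t _; apply/mpolyP => N; rewrite mcoeffD raddf_sum /=.
    have -> : \sum_(M <- msupp q) ((if (d < mdeg M)%N then
        t ^+ (mdeg M).-1 * q@_M else 0) *: 'X_[M])@_N =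
      (if (d < mdeg N)%N then t ^+ (mdeg N).-1 * q@_N else 0).
      under eq_bigr do rewrite mcoeffZ mcoeffX.
      have [Nq|Nq] := boolP (N \in msupp q).
        rewrite (bigD1_seq N) ?msupp_uniq //= eqxx mulr1 big1 ?addr0 // => M /negPf ->.
        by rewrite mulr0.
      rewrite [q@_N]memN_msupp_eq0 // mulr0 if_same big_seq big1 // => M Mq.
      by case: eqP => [E|_]; rewrite ?mulr0 // -E Mq in Nq *.
    have [->|t0] := eqVneq t 0.
      case: ltnP => [dN|_]; last by rewrite addr0.
      have -> : 0 ^+ (mdeg N).-1 = 0 :> K.
        by case: (mdeg N) dN => [|[|e]] //; [rewrite ltnS leqNgt d0 | rewrite expr0n].
      by rewrite mul0r addr0.
    rewrite !aut_mulE diag_invX unzE // autZ autZ mcoeffZ.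
    rewrite (mcoeff_diagonal _ N (x := fun=> t)) => [|l]; last by rewrite diagX unzE.
    rewrite prodrXr -mdegE -[phi 'X_i](subrK 'X_i) -/q
      (mcoeffD N q 'X_i) mulrDr mulrDr [RHS]addrC.
    congr (_ + _).
      rewrite mcoeffX; case: eqP => [<-|_]; last by rewrite !mulr0.
      by rewrite mdeg1 expr1 mulr1 mulVf.
    case: ltnP => [dN|Nd]; last by rewrite (Hphi i N) ?mulr0.
    have -> : mdeg N = (mdeg N).-1.+1 by rewrite (ltn_predK dN).
    by rewrite exprS mulrA mulrA mulVf // mul1r.
  apply: (famD rr); first exact: fam_cst.
  apply: (fam_sum rr) => M.
  apply: (famZ rr (a := fun t => if (d < mdeg M)%N then t ^+ (mdeg M).-1 * q@_M else 0)).
  case: ltnP => [dM|_]; last exact: (rr_cst rr).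
  exists 0, (q@_M *: 'X^((mdeg M).-1 - d)) => t.
  rewrite add0r hornerZ hornerXn mulrCA -exprD subnKC 1?mulrC //.
  by rewrite -ltnS (ltn_predK dM).
have Hg := fam_conj psi Hpsi.
have Hpsi' i : ordge d.+1 (aut_inv psi 'X_i - 'X_i).
  rewrite -opprB -scaleN1r; apply: ordgeZ.
  have := ordge_fix (aut_inv psi 'X_i) Hpsi.
  by rewrite -[psi (aut_inv psi _)]/((psi ** aut_inv psi) _) aut_mulV.
have Hg' i : fam (fun=> True) (@poly_gap K d) (fun t => aut_inv (g t) 'X_i).
  apply: (fam_ext rr) (fam_conj _ Hpsi' i) => t _; rewrite /g.
  by case: eqP => // _; rewrite !aut_inv_mul aut_invK aut_mulA.
move=> i N Nd.
have [_ /(_ N) [c [q Hq]]] := conj_fam Phi_ind alpha rr ng (fun j => Hg j) Hg' i.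
have c0 : c = ('X_i : R)@_N.
  have := Hq 0; rewrite /g eqxx conj_one // => ->.
  by rewrite expr0n eqn0Ngt d0 mul0r addr0.
have Hx t : t != 0 -> t ^+ mdeg N * (C psi 'X_i)@_N = t * (c + t ^+ d * q.[t]).
  move=> t0; rewrite -Hq /g (negPf t0).
  have Cs : C (s t) = s t by apply: C_diag.
  have -> : C (s t ** psi ** aut_inv (s t)) = s t ** C psi ** aut_inv (s t).
    rewrite (conj_mul PhiM); [|exact: ns|by apply/nice_tame/tame_inv|].
      rewrite (conj_mul PhiM); [|exact/nice_tame|exact: npsi|exact: ns].
      by rewrite conj_inv // Cs.
    by apply: nice_mul_tame => //; apply: tame_inv.
  rewrite -[X in t * X@__]/(s t (C psi (aut_inv (s t) 'X_i))).
  rewrite diag_invX unzE // autZ autZ mcoeffZ mulrA mulfV // mul1r.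
  rewrite (mcoeff_diagonal (f := s t) _ N (x := fun=> t)) => [|l]; last first.
    by rewrite /s diagX unzE.
  by rewrite prodrXr -mdegE.
have HP : (C psi 'X_i)@_N *: 'X^(mdeg N) - ('X * (c%:P + 'X^d * q)) = 0.
  apply: poly_eq0_horner_nz => t t0.
  rewrite hornerD hornerN hornerZ hornerXn mulrC Hx // hornerM hornerD hornerX.
  by rewrite hornerC hornerM hornerXn subrr.
(* In degree [mdeg N <= d] the summand ['X * ('X^d * q)] contributes nothing, which leaves [c] when
   [mdeg N = 1] and 0 otherwise. *)
have := congr1 (fun p : {poly K} => p`_(mdeg N)) HP.
rewrite coef0 coefB coefZ coefXn eqxx mulr1 coefXM mcoeffB.
have [N0|N0] := eqVneq (mdeg N) 0%N.
  rewrite subr0 => ->; rewrite mcoeffX; case: eqP => [E|_]; last by rewrite subrr.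
  by rewrite -E mdeg1 in N0.
rewrite coefD coefXnM coefC.
have -> : ((mdeg N).-1 < d)%N by rewrite prednK ?lt0n // -ltnS.
rewrite addr0 => <-; congr (_ - _).
case: eqP => [_|N1]; first by rewrite c0.
rewrite mcoeffX; case: eqP => // E.
by case: N1; rewrite -E mdeg1.
Qed.

(** Write [f = psi phi] with [phi] tame, hence fixed. Then [C f] and [f] differ only through [C psi]
    and [psi], both of which are the identity up to order [k.+2]; as [k] is arbitrary, the
    difference vanishes. *)
Lemma C_nice f : nice f -> C f = f.
Proof.
move=> nf; apply: aut_eqX => i; apply/eqP; rewrite -subr_eq0; apply/eqP.
apply: ordge_eq0 => k; apply: (@ordge_leq _ _ _ k.+2); first by rewrite ltnW.
have [psi [phi [tphi Ef Hpsi]]] := nf k.+2.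
have npsi : nice psi.
  have -> : psi = f ** aut_inv phi by rewrite Ef aut_mulKV.
  by apply: nice_mul_tame => //; apply: tame_inv.
have opsi j : ordge k.+2 (psi 'X_j - 'X_j) by apply: in_max_pow_ord.
have oC := C_preserves_order (ltn0Sn k) npsi opsi.
have -> : C f = C psi ** phi.
  rewrite -[X in _ ** X](C_tame tphi) -(conj_mul PhiM) -?Ef //.
  exact: nice_tame.
rewrite Ef !aut_mulE; set p := phi 'X_i.
have -> : C psi p - psi p = (C psi p - p) - (psi p - p) by ring.
by apply: ordgeB; apply: ordge_fix.
Qed.
End Rigidity.

Theorem theorem3p1p1 (K : closedFieldType) (n : nat) (hn : (3 <= n)%N)
    (Phi : NAut K n -> NAut K n) (hPhi : ind_automorphism Phi) :
  exists alpha : polyAut K n, forall f : NAut K n,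
    nval (Phi f) = aut_mul (aut_mul alpha f) (aut_inv alpha).
Proof.
have [PhiM Phi_ind [Psi [PhiK PsiK Psi_ind]]] := hPhi.
have [alpha [Cd Cc]] := exists_normalization (ltnW hn) PhiM Phi_ind PhiK Psi_ind.
have Cr := torus_fixed_root PhiM Phi_ind PhiK Psi_ind Cd.
exists alpha => f; rewrite -extendE -{2}(C_nice PhiM Phi_ind Cd Cc Cr (nvalP f)).
by rewrite /conjPhi !aut_mulA aut_mulV aut_1mul aut_mulKV.
Qed.
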